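(* Let $p\ge 2$ be a fixed natural number. The breadth-first-search algorithm described in the context (compute the arrangement of all separating hyperplanes, obtain its incidence graph, run the greedy algorithm in one cell, then traverse the incidence graph by breadth-first search using one independence test per newly reached cell) solves the $p$-parametric matroid problem in time $\mathcal{O}(m^{2p}f(m))$.
   Context: A matroid $\mathcal{M}=(E,\mathcal{F})$ consists of a finite ground set $E$ and a non-empty family $\mathcal{F}\subseteq 2^E$ of independent sets such that: $\emptyset\in\mathcal{F}$; subsets of independent sets are independent; and if $A,B\in\mathcal{F}$ with $|B|<|A|$, then $B\cup\{a\}\in\mathcal{F}$ for some $a\in A\setminus B$. A basis is an inclusion-wise maximal independent set. Put $m=|E|$. The time for a single independence test (deciding whether a given subset of $E$ is independent) is denoted by $f(m)$. Elementary arithmetic operations and comparisons count as constant time, and constants in the $\mathcal{O}$-notation may depend on the fixed number $p$. Each $e\in E$ has a $p$-parametric weight $w(e,\lambda)=a_e+\lambda_1 b_{1,e}+\dots+\lambda_p b_{p,e}$ with $a_e,b_{1,e},\dots,b_{p,e}\in\mathbb{Q}$. The parameter interval is $I=I_1\times\dots\times I_p\subseteq\mathbb{R}^p$, where each $I_i\subseteq\mathbb{R}$ is a real interval. The weight of a basis $B$ at $\lambda$ is $w(B,\lambda)=\sum_{e\in B}w(e,\lambda)$. A minimum weight basis $B^*_\lambda$ at $\lambda\in I$ is a basis with $w(B^*_\lambda,\lambda)\le w(B,\lambda)$ for all bases $B$ of $\mathcal{M}$. The $p$-parametric matroid problem is: given $\mathcal{M}$, the weights $w(e,\lambda)$ and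 $I$, compute a minimum weight basis $B^*_\lambda$ for each $\lambda\in I$. A solution is a decomposition of $I$ into subsets with one basis per subset that is a minimum weight basis at every $\lambda$ of that subset. For distinct $e,f\in E$ the separating hyperplane is $h(e,f)=\{\lambda\in\mathbb{R}^p:w(e,\lambda)=w(f,\lambda)\}$. It divides $\mathbb{R}^p$ into the open half-spaces $h^<(e,f)=\{\lambda:w(e,\lambda)<w(f,\lambda)\}$ and $h^>(e,f)=\{\lambda:w(e,\lambda)>w(f,\lambda)\}$. $H^{=}$ is the set of all separating hyperplanes. Standing assumption: (a) no two separating hyperplanes (for different unordered pairs) are identical; (b) no separating hyperplane is vertical, i.e. none contains a line parallel to the $p$-th coordinate axis. Each separating hyperplane is then taken to have dimension $p-1$. The arrangement $A(H)$ of a set $H=\{h_1,\dots,h_q\}$ of hyperplanes in $\mathbb{R}^d$ consists of the faces obtained as intersections in which, for each $i$, one chooses $h_i$ or one of its two open half-spaces; a cell is a $d$-dimensional face. The incidence graph $G(A(H))$ has one node $v_c$ for each cell $c$, and two nodes are adjacent if and only if their cells share a common face of dimension $d-1$. For $d\ge2$, the incremental algorithm of Edelsbrunner et al. (1986), which adds one hyperplane at a time, computes $A(H)$, with a point in the relative interior of every face and the incidences between faces, in $\mathcal{O}(q^d)$ time. The algorithm. Input: $\mathcal{M}$, the weights $w(e,\lambda)$ and $I$. 1. Compute $H^{=}$. 2. Compute $A(H^{=})$ with the algorithm of Edelsbrunner et al. 3. Obtain the incidence graph $G(A(H^{=}))$, storing for each edge the separating hyperplane $h(e,f)$ to which it belongs.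 4. Choose a vertex $v_{c'}$ of an arbitrary cell $c'$. 5. Use the greedy algorithm to compute a minimum weight basis at the stored point in the relative interior of $c'$. 6. Explore $G(A(H^{=}))$ by breadth-first search from $v_{c'}$. 7. For each vertex $v_c$ reached, perform one independence test to compute a minimum weight basis for $\lambda\in c$: if $v_c$ is reached from a cell $c_1$ with minimum weight basis $B$ across $h(e,f)$, where $c_1\subseteq h^<(e,f)$, test the set $(B\setminus\{e\})\cup\{f\}$; the basis for $c$ is this set if $e\in B$, $f\notin B$ and the set is independent, and is $B$ otherwise. 8. Return all cells $c$ of $A(H^{=})$ with their corresponding minimum weight bases. (The basis returned for a cell is used for all parameter vectors of $I$ in the closure of that cell, so that all of $I$ is covered.) *)

(* Defs.v *)
From HB Require Import structures.
From mathcomp Require Import all_boot all_order all_algebra.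
From mathcomp Require Import all_classical all_reals all_analysis.
Set Implicit Arguments.
Unset Strict Implicit.
Unset Printing Implicit Defensive.
Import Order.TTheory GRing.Theory Num.Theory.
Import numFieldNormedType.Exports.
Local Open Scope classical_set_scope.
Local Open Scope ring_scope.

Record matroid (E : finType) := Matroid {
  indep : {set {set E}};
  indep0 : finset.set0 \in indep;
  indepS : forall A B : {set E}, A \subset B -> B \in indep -> A \in indep;
  indep_aug : forall A B : {set E}, A \in indep -> B \in indep ->
    (#|B| < #|A|)%N ->
    exists2 x, x \in (A :\: B)%SET & (x |: B)%SET \in indep }.

Definition matroid_basis (E : finType) (M : matroid E) (B : {set E}) : Prop :=
  maxset [pred A | A \in indep M] B.

Section Arrangements.
Variables (R : realType) (d : nat).

Definition aff_indep k (x : 'I_k.+1 -> 'rV[R]_d) : bool :=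
  row_free (\matrix_(i < k) (x (lift ord0 i) - x ord0)).

(* The dimension of a nonempty set is the dimension of its affine hull. *)
Definition has_dim (S : set 'rV[R]_d) (k : nat) : Prop :=
  (exists x : 'I_k.+1 -> 'rV[R]_d, (forall i, S (x i)) /\ aff_indep x) /\
  (forall l (x : 'I_l.+1 -> 'rV[R]_d),
     (forall i, S (x i)) -> aff_indep x -> (l <= k)%N).

(* The pair (n, c) encodes the hyperplane {x | <n, x> + c = 0}; it is a genuine
   hyperplane only if n != 0. *)
Definition hyperplane : Type := ('rV[R]_d * R)%type.

Definition hval (h : hyperplane) (x : 'rV[R]_d) : R :=
  \sum_i h.1 0 i * x 0 i + h.2.

Definition side (h : hyperplane) (x : 'rV[R]_d) : comparison :=
  if hval h x < 0 then Lt else if hval h x == 0 then Eq else Gt.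

(* [part h Eq] is the hyperplane itself, [part h Lt] and [part h Gt] are its two
   open half-spaces. *)
Definition part (h : hyperplane) (s : comparison) : set 'rV[R]_d :=
  [set x | side h x = s].

Definition choice_face (H : set hyperplane) (s : hyperplane -> comparison) :
  set 'rV[R]_d := \bigcap_(h in H) part h (s h).

Definition is_face (H : set hyperplane) (F : set 'rV[R]_d) : Prop :=
  F !=set0 /\ exists s, F = choice_face H s.

(* The face of A(H) that contains the point x. *)
Definition face_at (H : set hyperplane) (x : 'rV[R]_d) : set 'rV[R]_d :=
  choice_face H (side^~ x).

(* A computed arrangement: its faces are numbered, and face k is given by its
   dimension, a point in its relative interior (faces are relatively open), the
   list of the faces of dimension one higher that it bounds, and, if it has
   dimension d - 1, the position in the input of the hyperplane it lies on.
   The finite functions are tables with constant-time access. *)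
Record arrangement := Arrangement {
  nfaces : nat;
  fdim : {ffun 'I_nfaces -> nat};
  fpt : {ffun 'I_nfaces -> 'rV[R]_d};
  fups : {ffun 'I_nfaces -> seq 'I_nfaces};
  fhyp : {ffun 'I_nfaces -> option nat} }.

Definition node_face (H : set hyperplane) (A : arrangement)
  (k : 'I_(nfaces A)) : set 'rV[R]_d := face_at H (fpt A k).

Definition proper_input (H : seq hyperplane) : Prop :=
  [/\ uniq H, {in H, forall h, h.1 != 0} &
      {in H &, injective (part^~ Eq)}].

Definition represents (H : seq hyperplane) (A : arrangement) : Prop :=
  let F := @node_face [set h | h \in H] A in
  [/\ injective F /\
        (forall S, is_face [set h | h \in H] S <-> exists k, S = F k),
      forall k, has_dim (F k) (fdim A k),
      forall k, uniq (fups A k),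
      forall k l, (l \in fups A k) <->
        fdim A l = (fdim A k).+1 /\ F k `<=` closure (F l) &
      forall k, fdim A k = d.-1 ->
        exists i h, [/\ fhyp A k = Some i, onth H i = Some h &
                        F k `<=` part h Eq]].

End Arrangements.

Arguments fdim {R d} _.
Arguments fpt {R d} _.
Arguments fups {R d} _.
Arguments fhyp {R d} _.

(* A computation is its result paired with the number of elementary steps it
   takes. *)
Definition timed (T : Type) : Type := (T * nat)%type.

Definition result T (c : timed T) : T := c.1.
Definition time T (c : timed T) : nat := c.2.

Definition spend T (n : nat) (x : T) : timed T := (x, n).

Definition bind T U (c : timed T) (k : T -> timed U) : timed U :=
  let r := k (result c) in (result r, (time c + time r)%N).

Notation "'let*' x ':=' c 'in' k" := (bind c (fun x => k))
  (at level 200, x name, c at level 200, k at level 200).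

Fixpoint for_each T S (s : seq T) (body : T -> S -> timed S) (st : S) :
  timed S :=
  if s is x :: s' then
    let* st1 := spend 1 st in
    let* st2 := body x st1 in
    for_each s' body st2
  else spend 1 st.

(* [arr] computes arrangements of hyperplanes in R^d in time O(q^d). *)
Definition arrangement_algorithm (R : realType) (d : nat)
  (arr : seq (hyperplane R d) -> timed (arrangement R d)) : Prop :=
  (forall H, proper_input H -> represents H (result (arr H))) /\
  (exists C N : nat, forall H, proper_input H -> (N <= size H)%N ->
     (time (arr H) <= C * size H ^ d)%N).

Section Problem.
Variables (R : realType) (p : nat) (E : finType) (M : matroid E).
Variables (a : E -> rat) (b : 'I_p -> E -> rat).

Definition weight (e : E) (x : 'rV[R]_p) : R :=
  ratr (a e) + \sum_i x 0 i * ratr (b i e).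

Definition weight_set (B : {set E}) (x : 'rV[R]_p) : R :=
  \sum_(e in B) weight e x.

Definition min_basis (B : {set E}) (x : 'rV[R]_p) : Prop :=
  matroid_basis M B /\ forall B', matroid_basis M B' -> weight_set B x <= weight_set B' x.

Definition param_box (I : 'I_p -> interval R) : set 'rV[R]_p :=
  [set x | forall i, x 0 i \in I i].

Definition decomposition n (S : 'I_n -> set 'rV[R]_p) (D : set 'rV[R]_p) :
  Prop :=
  \bigcup_i S i = D /\ forall i j, i != j -> interior (S i `&` S j) = set0.

Definition solution (D : set 'rV[R]_p) n (S : 'I_n -> set 'rV[R]_p)
  (B : 'I_n -> {set E}) : Prop :=
  decomposition S D /\ forall i x, S i x -> min_basis (B i) x.

Definition sep (e f : E) : set 'rV[R]_p := [set x | weight e x = weight f x].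

Definition vertical (S : set 'rV[R]_p) : Prop :=
  exists (i : 'I_p) (x : 'rV[R]_p), i.+1 = p :> nat /\
    forall t : R, S (x + t *: delta_mx 0 i).

Definition general_position : Prop :=
  [/\ forall e f e' f', e != f -> e' != f' -> sep e f = sep e' f' ->
        [set e; f]%SET = [set e'; f']%SET,
      forall e f, e != f -> ~ vertical (sep e f) &
      forall e f, e != f -> has_dim (sep e f) p.-1].

(* Encodes h(e, f): the value of this hyperplane at x is
   weight e x - weight f x. *)
Definition sep_hyp (e f : E) : hyperplane R p :=
  (\row_i (ratr (b i e) - ratr (b i f)), ratr (a e) - ratr (a f)).

(* Each unordered pair contributes one encoding. *)
Definition sep_hyps : set (hyperplane R p) :=
  [set h | exists e f, (enum_rank e < enum_rank f)%N /\ h = sep_hyp e f].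

End Problem.

Section Algorithm.
Variables (R : realType) (p : nat).
Variable arr : seq (hyperplane R p) -> timed (arrangement R p).
Variables (E : finType) (M : matroid E).
Variables (a : E -> rat) (b : 'I_p -> E -> rat).
(* Time of one independence test. The set to be tested has to be written down
   for the test, which is part of this time. *)
Variable ftest : nat -> nat.
(* The choice, from a nonempty list of nodes, of the one to start from. *)
Variable start : forall n, 'I_n -> seq 'I_n -> 'I_n.

Local Notation pt := 'rV[R]_p.

Definition test (S : {set E}) : timed bool :=
  spend (ftest #|E|) (S \in indep M).

(* p multiplications and p additions *)
Definition eval_weight (e : E) (x : pt) : timed R :=
  spend (2 * p) (weight a b e x).

Definition compute_sep : timed (seq ((E * E) * hyperplane R p)) :=
  for_each (enum E) (fun e acc1 =>
    for_each (enum E) (fun f acc2 =>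
      let* lt := spend 1 (enum_rank e < enum_rank f)%N in
      if lt then
        let* h := spend p.+1 (sep_hyp R a b e f) in
        spend 1 (((e, f), h) :: acc2)
      else spend 0 acc2) acc1) [::].

Definition update n T (t : {ffun 'I_n -> T}) (k : 'I_n) (v : T) :
  timed {ffun 'I_n -> T} :=
  spend 1 [ffun j => if j == k then v else t j].

Definition new_table n T (v : T) : timed {ffun 'I_n -> T} :=
  spend n [ffun => v].

(* The nodes of the incidence graph are the cells; the adjacency list
   of a cell holds its neighbours together with the pair (e, f) such that the
   common face of dimension p - 1 lies on h(e, f). *)
Definition adjacency n : Type := {ffun 'I_n -> seq ('I_n * (E * E))}.

Definition list_cells (A : arrangement R p) : timed (seq 'I_(nfaces A)) :=
  for_each (enum 'I_(nfaces A)) (fun k acc =>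
    let* iscell := spend 1 (fdim A k == p) in
    if iscell then spend 1 (k :: acc) else spend 0 acc) [::].

Definition incidence_graph (A : arrangement R p) (pairs : seq (E * E)) :
  timed (adjacency (nfaces A)) :=
  let* adj0 := new_table (nfaces A) [::] in
  for_each (enum 'I_(nfaces A)) (fun g adj1 =>
    let* isfacet := spend 1 (fdim A g == p.-1) in
    if ~~ isfacet then spend 0 adj1 else
    let* ef := spend 2 (obind (onth pairs) (fhyp A g)) in
    if ef is Some ef then
      for_each (fups A g) (fun c1 adj2 =>
        for_each (fups A g) (fun c2 adj3 =>
          let* new := spend 1 (c1 != c2) in
          if new then update adj3 c1 ((c2, ef) :: adj3 c1)
          else spend 0 adj3) adj2) adj1
    else spend 0 adj1) adj0.

Fixpoint insert (x : E * R) (s : seq (E * R)) : timed (seq (E * R)) :=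
  if s is y :: s' then
    let* le := spend 1 (x.2 <= y.2) in
    if le then spend 1 (x :: s)
    else let* r := insert x s' in spend 1 (y :: r)
  else spend 1 [:: x].

Definition sort_by_weight (x : pt) : timed (seq (E * R)) :=
  for_each (enum E) (fun e acc =>
    let* w := eval_weight e x in insert (e, w) acc) [::].

Definition greedy (x : pt) : timed {set E} :=
  let* s := sort_by_weight x in
  for_each s (fun ew B =>
    let* ok := test (ew.1 |: B)%SET in
    spend 1 (if ok then ew.1 |: B else B)%SET) finset.set0.

(* The minimum weight basis after crossing h(e, f) from the cell with
   stored point x and minimum weight basis B. *)
Definition cross (x : pt) (ef : E * E) (B : {set E}) : timed {set E} :=
  let* we := eval_weight ef.1 x in
  let* wf := eval_weight ef.2 x in
  let* lt := spend 1 (we < wf) in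
  let e := if lt then ef.1 else ef.2 in
  let f := if lt then ef.2 else ef.1 in
  let B' := (f |: (B :\ e))%SET in
  let* ok := test B' in
  spend 3 (if [&& e \in B, f \notin B & ok] then B' else B).

(* The state of the search is the queue, holding the reached cells that are
   still to be expanded with their bases, and the table of the bases found so
   far. Enqueueing (rcons) and dequeueing take constant time. *)
Definition bfs_state n : Type :=
  (seq ('I_n * {set E}) * {ffun 'I_n -> option {set E}})%type.

Definition visit (A : arrangement R p) (c1 : 'I_(nfaces A)) (B : {set E})
  (edge : 'I_(nfaces A) * (E * E)) (st : bfs_state (nfaces A)) :
  timed (bfs_state (nfaces A)) :=
  let* seen := spend 1 (isSome (st.2 edge.1)) in
  if seen then spend 0 st else
  let* B' := cross (fpt A c1) edge.2 B in
  let* bases := update st.2 edge.1 (Some B') in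
  spend 1 (rcons st.1 (edge.1, B'), bases).

(* Every node enters the queue at most once, so that nfaces A iterations always
   suffice to empty it. *)
Fixpoint bfs_loop (A : arrangement R p) (adj : adjacency (nfaces A))
  (fuel : nat) (st : bfs_state (nfaces A)) : timed (bfs_state (nfaces A)) :=
  match fuel, st.1 with
  | fuel'.+1, cB :: queue =>
      let* st1 := spend 1 (queue, st.2) in
      let* st2 := for_each (adj cB.1) (visit cB.1 cB.2) st1 in
      bfs_loop adj fuel' st2
  | _, _ => spend 1 st
  end.

Record answer := Answer {
  ans_arr : arrangement R p;
  ans_cells : seq ('I_(nfaces ans_arr) * {set E}) }.

Definition bfs_algorithm : timed answer :=
  let* L := compute_sep in
  let* pairs := spend (size L) (unzip1 L) in
  let* H := spend (size L) (unzip2 L) in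
  let* A := arr H in
  let* cells := list_cells A in
  let* adj := incidence_graph A pairs in
  if cells is c :: cs then
    let* c0 := spend 1 (start c cs) in
    let* B0 := greedy (fpt A c0) in
    let* none := new_table (nfaces A) None in
    let* bases0 := update none c0 (Some B0) in
    let* st := bfs_loop adj (nfaces A) ([:: (c0, B0)], bases0) in
    let* out := for_each cells (fun k acc =>
      spend 1 (if st.2 k is Some B then (k, B) :: acc else acc)) [::] in
    spend 1 (@Answer A out)
  else spend 1 (@Answer A [::]).

(* The part of the parameter set D covered by the i-th returned cell, and the
   basis returned for it. *)
Definition ans_part (D : set pt) (r : answer) (i : 'I_(size (ans_cells r))) :
  set pt :=
  D `&` closure (node_face (@sep_hyps R p E a b)
    (tnth (in_tuple (ans_cells r)) i).1).

Definition ans_basis (r : answer) (i : 'I_(size (ans_cells r))) : {set E} :=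
  (tnth (in_tuple (ans_cells r)) i).2.

Definition solves (D : set pt) (r : answer) : Prop :=
  solution M a b D (@ans_part D r) (@ans_basis r).

End Algorithm.

(* Main.v *)
Require Import Defs.
From mathcomp Require Import all_boot all_order all_algebra.
From mathcomp Require Import all_classical all_reals all_analysis.
From mathcomp Require Import ring lra zify.
Set Implicit Arguments.
Unset Strict Implicit.
Unset Printing Implicit Defensive.
Import Order.TTheory GRing.Theory Num.Theory.
Import numFieldNormedType.Exports.
Local Open Scope ring_scope.

(* Let H be the set of separating hyperplanes. A basis B has minimum weight at x
   as soon as w(g, x) <= w(k, x) for every exchange B - g + k that is a basis, so
   optimality depends only on the order of the weights at x, and passes from a
   point to every point where these inequalities persist; in particular from a
   cell of A(H) to its closure. By general position, e and f are the only
   elements whose weights tie on a facet of A(H) contained in h(e, f). A basis B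
   that is optimal in one cell of the facet is optimal on the facet, and if it
   fails the exchange criterion in the other cell, then it does so only for
   (g, k) = (e, f), in which case B - e + f is optimal there.
   The search reaches every cell: after moving a point of a cell to general
   position, the segment to a point of the target cell crosses the hyperplanes
   one at a time, and its first crossing is a facet leading to a cell with fewer
   hyperplanes between it and the target.
   For the running time, A(H) has at most (2 q + 1)^p faces if H consists of
   q <= m^2 hyperplanes, and a facet bounds at most two cells; hence the
   incidence graph has O(m^(2p)) edges. *)

(** * Minimum weight bases *)

Section MatroidBases.
Variables (E : finType) (M : matroid E).
Implicit Types A B X : {set E}.

Lemma basisP B :
  matroid_basis M B <->
  B \in indep M /\ forall A, A \in indep M -> (#|A| <= #|B|)%N.
Proof.
split=> [/maxsetP [/= Bi Bmax]|[Bi Bmax]].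
  split=> // A Ai; rewrite leqNgt; apply/negP => /(indep_aug Ai Bi) [x].
  rewrite inE => /andP [xB _] xBi.
  by move: xB; rewrite -(Bmax _ xBi) ?finset.setU11 // finset.subsetUr.
apply/maxsetP; split=> // A Ai BA; apply/esym/eqP.
by rewrite eqEcard BA Bmax.
Qed.

Lemma basis_card B B' :
  matroid_basis M B -> matroid_basis M B' -> #|B| = #|B'|.
Proof.
move=> /basisP [Bi Bm] /basisP [Bi' Bm'].
by apply/eqP; rewrite eqn_leq Bm' // Bm.
Qed.

Lemma basis_of_card B A :
  matroid_basis M B -> A \in indep M -> #|A| = #|B| -> matroid_basis M A.
Proof. by move=> /basisP [_ Bm] Ai AB; apply/basisP; rewrite AB. Qed.

(** Induction on the number of elements that [A] lacks for a basis; each augmentation takes its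
    element from [B]. *)
Lemma indep_extend A B :
  A \in indep M -> matroid_basis M B ->
  exists2 X, matroid_basis M X & (A \subset X) && (X \subset A :|: B)%SET.
Proof.
move=> Ai /[dup] Bb /basisP [Bi Bmax].
have [n] := ubnP (#|B| - #|A|); elim: n A Ai => // n IH A Ai leAn.
have [AB|BA] := ltnP #|A| #|B|; last first.
  exists A; last by rewrite fintype.subxx finset.subsetUl.
  by apply: (basis_of_card Bb) => //; apply/eqP; rewrite eqn_leq BA Bmax.
have [x] := indep_aug Bi Ai AB; rewrite inE => /andP [xA xB] xAi.
have [|X Xb /andP [AX XAB]] := IH _ xAi.
  by rewrite cardsU1 xA; lia.
exists X => //; apply/andP; split.
  by apply: fintype.subset_trans AX; apply: finset.subsetUr.
apply: (fintype.subset_trans XAB); rewrite !finset.subUset finset.subsetUl.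
rewrite finset.subsetUr finset.sub1set.
by rewrite inE xB orbT.
Qed.

(** Extending [h |: A] by elements of [B] gives a basis [X] that apart from [h] lies in [B] and so
    misses exactly one element of [B], which is [g]. *)
Lemma basis_exchange B A h :
  matroid_basis M B -> A \subset B -> h \notin B -> (h |: A)%SET \in indep M ->
  exists2 g, g \in (B :\: A)%SET & matroid_basis M (h |: (B :\ g))%SET.
Proof.
move=> Bb AB hB hA; have [X Xb /andP [hAX XB]] := indep_extend hA Bb.
have hX : h \in X by rewrite (fintype.subsetP hAX) // finset.setU11.
have XhB : (X :\ h \subset B)%SET.
  apply/fintype.subsetP => x; rewrite !inE => /andP [xh /(fintype.subsetP XB)].
  by rewrite !inE (negPf xh) /= => /orP [/(fintype.subsetP AB)|].
have cX : #|(X :\ h)%SET|.+1 = #|B| by rewrite -(basis_card Xb Bb) (cardsD1 h X) hX.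
have [g gB gX] : exists2 g, g \in B & g \notin (X :\ h)%SET.
  apply/fintype.subsetPn; apply/negP => /subset_leq_card; lia.
exists g.
  rewrite inE gB andbT; apply: contra gX => gA; rewrite !inE.
  rewrite (fintype.subsetP hAX) ?inE ?gA ?orbT // andbT.
  by apply: contraNneq hB => <-; apply: (fintype.subsetP AB).
suff -> : (h |: (B :\ g) = X)%SET by [].
apply/esym/eqP; rewrite eqEcard; apply/andP; split.
  apply/fintype.subsetP => x xX; rewrite !inE; case: eqVneq => //= xh.
  have xXh : x \in (X :\ h)%SET by rewrite !inE xh.
  rewrite (fintype.subsetP XhB) // andbT; apply: contraNneq gX => <- //.
rewrite cardsU1 !inE (negPf hB) andbF /= (basis_card Xb Bb).
by rewrite (cardsD1 g B) gB.
Qed.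

Lemma swap_basis B g h :
  matroid_basis M B -> g \in B -> h \notin B -> (h |: (B :\ g))%SET \in indep M ->
  matroid_basis M (h |: (B :\ g))%SET.
Proof.
move=> Bb gB hB hi; apply: (basis_of_card Bb) => //.
by rewrite cardsU1 !inE (negPf hB) andbF /= (cardsD1 g B) gB.
Qed.

Variables (R : realDomainType) (w : E -> R).

Lemma sum_swap B g h : g \in B -> h \notin B ->
  \sum_(e in (h |: (B :\ g))%SET) w e = \sum_(e in B) w e - w g + w h.
Proof.
move=> gB hB; rewrite big_setU1 ?inE ?(negPf hB) ?andbF //=.
by rewrite (big_setD1 g gB) /= [w g + _]addrC addrK addrC.
Qed.

(** Induction on [#|B' :\: B|]. The lightest [g] of [B] outside [B'] is exchanged into [B'] against
    some [h] outside [B]; once [w g <= w h] is known, the new basis is no heavier than [B'] and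
    closer to [B]. *)
Lemma local_min_basis B :
  matroid_basis M B ->
  (forall g h, g \in B -> h \notin B -> (h |: (B :\ g))%SET \in indep M ->
     w g <= w h) ->
  forall B', matroid_basis M B' -> \sum_(e in B) w e <= \sum_(e in B') w e.
Proof.
move=> Bb Bloc B'; have [n] := ubnP #|(B' :\: B)%SET|.
elim: n B' => // n IH B' leB'n B'b.
have cBB' := basis_card B'b Bb.
have [BB'|BB'] := boolP (B \subset B').
  suff -> : B = B' by [].
  by apply/eqP; rewrite eqEcard BB' cBB' /=.
have /fintype.subsetPn [g0 g0B g0B'] := BB'.
have g0P : g0 \in (B :\: B')%SET by rewrite inE g0B'.
have [g gP gmin] : exists2 g, g \in (B :\: B')%SET &
    forall x, x \in (B :\: B')%SET -> w g <= w x.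
  by case: (Order.TotalTheory.arg_minP w g0P) => g gP gmin; exists g.
have {gP} /andP [gB' gB] : (g \notin B') && (g \in B) by rewrite inE in gP.
have gi : (g |: (B :&: B'))%SET \in indep M.
  have /basisP [Bi _] := Bb; apply: indepS Bi.
  by rewrite finset.subUset finset.sub1set gB finset.subsetIl.
have [h] := basis_exchange B'b (finset.subsetIr B B') gB' gi.
rewrite !inE => /andP []; rewrite negb_and => /[swap] hB'; rewrite hB' orbF => hB Xb.
have wgh : w g <= w h.
  rewrite leNgt; apply/negP => whg.
  (* If [h] were lighter than [g], the elements of [B] no heavier than [h] would all lie in [B'] by
     the choice of [g]. They are then independent together with [h], so exchanging [h] into [B]
     expels some heavier [k], against local optimality. *)
  have hi : (h |: (B :&: finset (fun x => w x <= w h)))%SET \in indep M.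
    have /basisP [B'i _] := B'b; apply: indepS B'i.
    rewrite finset.subUset finset.sub1set hB' /=.
    apply/fintype.subsetP => x /finset.setIP [xB]; rewrite finset.in_set => xh.
    apply/negPn/negP => xB'; have := gmin x; rewrite inE xB' xB => /(_ isT).
    by move/(lt_le_trans whg)/(le_lt_trans xh); rewrite ltxx.
  have [|k] := basis_exchange Bb _ hB hi.
    exact: finset.subsetIl.
  rewrite inE finset.in_setI finset.in_set => /andP [kP kB] /basisP [ki _].
  by move: kP; rewrite kB (Bloc k h).
have /(_ _ Xb) := IH (g |: (B' :\ h))%SET.
have : (#|((g |: (B' :\ h)) :\: B)%SET| < n)%N.
  apply: (@leq_trans #|(B' :\: B)%SET|); last by rewrite -ltnS.
  apply: proper_card; apply/properP; split.
    apply/fintype.subsetP => x; rewrite !inE => /andP [xB] /orP [/eqP xg|/andP [_ ->]].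
      by move: xB; rewrite xg gB.
    by rewrite xB.
  exists h; first by rewrite !inE hB hB'.
  rewrite !inE eqxx /= orbF negb_and; apply/orP; right.
  by apply: contraNneq hB => ->.
move=> lt1 /(_ lt1) /le_trans; apply.
by rewrite sum_swap // -addrA gerDl addrC subr_le0.
Qed.

Lemma min_basis_local B :
  matroid_basis M B ->
  (forall B', matroid_basis M B' -> \sum_(e in B) w e <= \sum_(e in B') w e) ->
  forall g h, g \in B -> h \notin B -> (h |: (B :\ g))%SET \in indep M ->
  w g <= w h.
Proof.
move=> Bb Bmin g h gB hB hi.
have := Bmin _ (swap_basis Bb gB hB hi).
by rewrite sum_swap // -addrA lerDl addrC subr_ge0.
Qed.

Definition greedy_set (s : seq E) : {set E} :=
  foldl (fun B e => if (e |: B)%SET \in indep M then e |: B else B)%SET finset.set0 s.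

Lemma greedy_set_rcons s x : greedy_set (rcons s x) =
  (if (x |: greedy_set s)%SET \in indep M then x |: greedy_set s else greedy_set s)%SET.
Proof. by rewrite /greedy_set foldl_rcons. Qed.

Lemma greedy_set_indep s : greedy_set s \in indep M.
Proof.
elim/last_ind: s => [|s x IH]; first exact: indep0.
by rewrite greedy_set_rcons; case: ifP.
Qed.

Lemma greedy_set_sub s x : x \in greedy_set s -> x \in s.
Proof.
elim/last_ind: s => [|s y IH]; first by rewrite /greedy_set /= inE.
rewrite greedy_set_rcons mem_rcons inE; case: ifP => _.
  by rewrite !inE => /orP [->//|/IH ->]; rewrite orbT.
by move/IH ->; rewrite orbT.
Qed.

Lemma greedy_set_cat s1 s2 : greedy_set s1 \subset greedy_set (s1 ++ s2).
Proof.
elim/last_ind: s2 => [|s2 y IH]; first by rewrite cats0.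
rewrite -rcons_cat greedy_set_rcons; case: ifP => // _.
by apply: (fintype.subset_trans IH); apply: finset.subsetUr.
Qed.

Lemma greedy_set_reject s1 x s2 : x \notin greedy_set (s1 ++ x :: s2) ->
  (x |: greedy_set s1)%SET \notin indep M.
Proof.
move=> xn; apply: contraNN xn => xi; rewrite -cat_rcons.
apply: (fintype.subsetP (greedy_set_cat _ _)).
by rewrite greedy_set_rcons xi finset.setU11.
Qed.

(** A rejected [h] is dependent on the elements chosen before it. If replacing [g] by [h] lowered
    the weight, [g] would come after [h] in the sorted list, so these elements would survive the
    exchange and make its result dependent. *)
Lemma greedy_min_basis s :
  (forall e, e \in s) -> sorted (fun e f => w e <= w f) s ->
  matroid_basis M (greedy_set s) /\
  forall B', matroid_basis M B' -> \sum_(e in greedy_set s) w e <= \sum_(e in B') w e.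
Proof.
move=> sE ss.
have rej h : h \notin greedy_set s -> exists s1 s2, s = s1 ++ h :: s2 /\
    (h |: greedy_set s1)%SET \notin indep M.
  move=> hn; pose i := index h s.
  have Es : s = take i s ++ h :: drop i.+1 s.
    by rewrite -{1}[s](cat_take_drop i) (drop_nth h) ?index_mem // nth_index.
  exists (take i s), (drop i.+1 s); split=> //.
  by move: hn; rewrite {1}Es; apply: greedy_set_reject.
suff Gb : matroid_basis M (greedy_set s).
  split=> //; apply: local_min_basis => // g h gB hB hi; rewrite leNgt; apply/negP => whg.
  have [s1 [s2 [def_s /negP []]]] := rej h hB.
  apply: indepS hi; apply: finset.setUS; apply/fintype.subsetP => x xs1.
  rewrite !inE def_s (fintype.subsetP (greedy_set_cat _ _)) // andbT.
  apply: contraTneq (greedy_set_sub xs1) => ->; apply/negP => gs1.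
  have tr : transitive (fun e f : E => w e <= w f) by move=> ? ? ? /le_trans; apply.
  move: ss; rewrite def_s sorted_pairwise // pairwise_cat => /and3P [/allrelP /(_ g h gs1)].
  by rewrite inE eqxx leNgt whg => /(_ isT).
apply/maxsetP; split=> /= [|A Ai GA]; first exact: greedy_set_indep.
apply/eqP; rewrite finset.eqEsubset GA andbT; apply/fintype.subsetP => h hA.
apply/negPn/negP => /rej [s1 [s2 [def_s /negP []]]]; apply: indepS Ai.
rewrite finset.subUset finset.sub1set hA; apply: fintype.subset_trans GA.
by rewrite def_s; apply: greedy_set_cat.
Qed.

End MatroidBases.

(** * Affine forms *)

Section AffineForms.
Local Open Scope classical_set_scope.
Variables (R : realType) (d : nat).
Implicit Types (h : hyperplane R d) (x y z v n : 'rV[R]_d).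

(** The linear part of an affine form: [slope h.1 v] is the rate of change of [hval h] in direction
    [v]. *)
Definition slope n v : R := \sum_i n 0 i * v 0 i.

Lemma slopeE n v : slope n v = (v *m n^T) 0 0.
Proof. by rewrite mxE; apply: eq_bigr => i _; rewrite mxE mulrC. Qed.

Lemma hvalE h x : hval h x = slope h.1 x + h.2.
Proof. by []. Qed.

Lemma slopeDZ n x v t : slope n (x + t *: v) = slope n x + t * slope n v.
Proof.
by rewrite /slope mulr_sumr -big_split /=; apply: eq_bigr => i _; rewrite !mxE; ring.
Qed.

Lemma slopeB n x y : slope n (x - y) = slope n x - slope n y.
Proof. by rewrite -scaleN1r slopeDZ mulN1r. Qed.

Lemma hvalDZ h x v t : hval h (x + t *: v) = hval h x + t * slope h.1 v.
Proof. by rewrite !hvalE slopeDZ; ring. Qed.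

Lemma hval_segment h x y t :
  hval h (x + t *: (y - x)) = (1 - t) * hval h x + t * hval h y.
Proof. by rewrite hvalDZ slopeB !hvalE; ring. Qed.

Lemma hvalN h x : hval (- h.1, - h.2) x = - hval h x.
Proof.
rewrite !hvalE opprD /slope -sumrN; congr (_ + _).
by apply: eq_bigr => i _; rewrite mxE mulNr.
Qed.

Lemma slope_self_gt0 n : n != 0 -> 0 < slope n n.
Proof.
move=> n0; rewrite lt0r sumr_ge0 ?andbT; last by move=> i _; rewrite -expr2 sqr_ge0.
apply: contra n0; rewrite /slope psumr_eq0; last by move=> i _; rewrite -expr2 sqr_ge0.
move=> /allP n0; apply/eqP/rowP => i; rewrite mxE.
by have /implyP /(_ isT) := n0 i (mem_index_enum i); rewrite mulf_eq0 orbb => /eqP.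
Qed.

Lemma side_sgE h x y : side h x = side h y <-> Num.sg (hval h x) = Num.sg (hval h y).
Proof.
by rewrite /side; split;
   case: (ltgtP (hval h x) 0) => [x0|x0|->]; case: (ltgtP (hval h y) 0) => [y0|y0|->] //;
   rewrite ?(ltr0_sg x0) ?(ltr0_sg y0) ?(gtr0_sg x0) ?(gtr0_sg y0) ?sgr0 // => H; exfalso; lra.
Qed.

Lemma side_Eq h x : side h x = Eq <-> hval h x = 0.
Proof. by rewrite /side; case: ltgtP => [x0|x0|->]; split=> // E; move: x0; rewrite E ltxx. Qed.

Lemma face_atP (H : set (hyperplane R d)) x y :
  face_at H x y <-> forall h, H h -> Num.sg (hval h y) = Num.sg (hval h x).
Proof.
by split=> [+ h Hh|+ h Hh]; [move/(_ h Hh)/side_sgE | move/(_ h Hh) => ?; apply/side_sgE].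
Qed.

Lemma small_sg (s : seq (R * R)) :
  exists2 e : R, 0 < e & forall t, 0 <= t <= e -> forall ab, ab \in s ->
    ab.1 != 0 -> Num.sg (ab.1 + t * ab.2) = Num.sg ab.1.
Proof.
elim: s => [|[a b] s [e e0 He]]; first by exists 1.
have [a0|a0] := eqVneq a 0.
  exists e => // t te ab; rewrite inE => /orP [/eqP ->|]; first by rewrite a0 eqxx.
  exact: He.
have b1 : 0 < `|b| + 1 by apply: ltr_wpDl.
(* Up to this bound [t * b] stays below [a] in absolute value; the added 1 keeps the divisor
   positive when [b] is 0. *)
pose e1 := `|a| / 2 / (`|b| + 1).
have e10 : 0 < e1 by rewrite !divr_gt0 ?normr_gt0.
exists (Num.min e e1); first by rewrite lt_min e0.
move=> t /andP [t0]; rewrite le_min => /andP [te te1] ab; rewrite inE.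
move=> /orP [/eqP ->|abs] /= ab0; last by apply: He; rewrite ?t0.
have : `|t * b| < `|a|.
  rewrite normrM (ger0_norm t0).
  have : t * (`|b| + 1) <= `|a| / 2 by rewrite -ler_pdivlMr.
  have : 0 < `|a| by rewrite normr_gt0.
  nra.
case: (ltgtP a 0) ab0 => // ha _.
  rewrite (ltr0_norm ha) => /ltr_normlW tb; rewrite !ltr0_sg //; lra.
rewrite (gtr0_norm ha) => /ltrNnormlW tb; rewrite !gtr0_sg //; lra.
Qed.

Lemma small_step (G : seq (hyperplane R d)) x v :
  exists2 e : R, 0 < e & forall t, 0 <= t <= e -> forall h, h \in G ->
    hval h x != 0 -> Num.sg (hval h (x + t *: v)) = Num.sg (hval h x).
Proof.
have [e e0 He] := small_sg [seq (hval h x, slope h.1 v) | h <- G].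
exists e => // t te h hG hx; rewrite hvalDZ.
by apply: (He t te (hval h x, slope h.1 v)) => //; apply: (map_f (fun h => (hval h x, slope h.1 v))).
Qed.

(** A normal vanishing on the direction found so far is repaired by adding a small multiple of that
    normal, under which the slopes already nonzero keep their signs. *)
Lemma generic_direction (s : seq 'rV[R]_d) :
  exists v, forall n, n \in s -> n != 0 -> slope n v != 0.
Proof.
elim: s => [|n s [v Hv]]; first by exists 0.
have [e e0 He] := small_sg [seq (slope n' v, slope n' n) | n' <- s].
have [nv|nv] := eqVneq (slope n v) 0; last first.
  by exists v => n'; rewrite inE => /orP [/eqP ->|/Hv].
exists (v + e *: n) => n'; rewrite inE slopeDZ => /orP [/eqP -> n0|n's n'0].
  by rewrite nv add0r mulf_neq0 ?gt_eqF // slope_self_gt0.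
have /= He' := He e _ (slope n' v, slope n' n).
rewrite -sgr_eq0 He' ?sgr_eq0 ?Hv ?(ltW e0) ?lexx //.
exact: (map_f (fun n' => (slope n' v, slope n' n))).
Qed.

(** This moves a point into general position: forms that are zero at [x] leave zero along a generic
    direction, and a short step preserves the signs of the others. *)
Lemma generic_step (G : seq (hyperplane R d)) x :
  exists v, exists2 e : R, 0 < e & forall t, 0 < t <= e -> forall h, h \in G ->
    (hval h x != 0 -> Num.sg (hval h (x + t *: v)) = Num.sg (hval h x)) /\
    (h != 0 -> hval h (x + t *: v) != 0).
Proof.
have [v Hv] := generic_direction (map fst G).
have [e e0 He] := small_step G x v.
exists v; exists e => // t /andP [t0 te] h hG.
have Hs : hval h x != 0 -> Num.sg (hval h (x + t *: v)) = Num.sg (hval h x).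
  by apply: He; rewrite // (ltW t0).
split=> // h0; have [hx|hx] := eqVneq (hval h x) 0; last first.
  by rewrite -sgr_eq0 Hs // sgr_eq0.
(* A nonzero form without linear part is a nonzero constant, so it cannot vanish at [x]. *)
have [n0|n0] := eqVneq h.1 0.
  apply: contraNneq h0; rewrite hvalE n0 /slope big1 ?add0r; last by move=> i _; rewrite mxE mul0r.
  by case: h n0 {hG Hs hx} => /= ? ? -> ->.
by rewrite hvalDZ hx add0r mulf_eq0 (gt_eqF t0) /=; apply: Hv => //; apply: map_f.
Qed.

Lemma closure_ray (S : set 'rV[R]_d) x v e : 0 < e ->
  (forall t, 0 < t <= e -> S (x + t *: v)) -> closure S x.
Proof.
move=> e0 HS B /nbhs_ballP [r /= r0 rB].
pose t := Num.min e (r / 2 / (`|v| + 1)).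
have v1 : 0 < `|v| + 1 by apply: ltr_wpDl.
have t0 : 0 < t by rewrite lt_min e0 !divr_gt0.
exists (x + t *: v); split; first by apply: HS; rewrite t0 ge_min lexx.
apply: rB; rewrite -ball_normE /=.
rewrite opprD addNKr normrN normrZ (gtr0_norm t0).
have : t * (`|v| + 1) <= r / 2 by rewrite -ler_pdivlMr // ge_min lexx orbT.
have : 0 <= `|v| := normr_ge0 v.
nra.
Qed.

Lemma hval_continuous h : continuous (hval h).
Proof.
move=> x.
have cvg_slope : (fun y => slope h.1 y) @ nbhs x --> slope h.1 x.
  apply: cvg_big => [|i _]; first exact: (@pseudometric_normed_Zmodule.add_continuous R R).
  have ci : (fun y : 'rV[R]_d => y 0 i) @ nbhs x --> x 0 i by apply: coord_continuous.
  exact: (cvgM (cvg_cst (h.1 0 i)) ci).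
exact: (cvgD cvg_slope (cvg_cst h.2)).
Qed.

Lemma closure_hval_ge0 (S : set 'rV[R]_d) h x : closure S x ->
  (forall y, S y -> 0 <= hval h y) -> 0 <= hval h x.
Proof.
move=> Sx Sh; have /(_ _ Sx) : closure S `<=` [set y | 0 <= hval h y].
  rewrite [X in _ `<=` X](_ : _ = closure [set y | 0 <= hval h y]).
    by apply: closureS => y /Sh.
  apply/closure_id; apply: (@preimage_closed _ _ (hval h) [set t | 0 <= t]).
    by move=> y _; apply: hval_continuous.
  exact: closed_ge.
by [].
Qed.

End AffineForms.

(** * Faces of arrangements *)

Section FaceDimension.
Local Open Scope classical_set_scope.
Variables (R : realType) (d : nat).
Implicit Types (h : hyperplane R d) (x y z v n : 'rV[R]_d).
Implicit Types (S : set 'rV[R]_d) (H : seq (hyperplane R d)).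

(** The [k] differences of affinely independent points are linearly independent and annihilated by
    [N], so the two ranks add up to at most [d]. *)
Lemma has_dim_le S k m (N : 'M[R]_(d, m)) : has_dim S k ->
  (forall x y, S x -> S y -> (x - y) *m N = 0) -> (k + \rank N <= d)%N.
Proof.
move=> [[x [Sx]] xfree _] SN.
rewrite /aff_indep in xfree; set D := (X in row_free X) in xfree; have DN : D *m N = 0.
  apply/row_matrixP => i; rewrite row_mul row0 rowK; exact: SN.
by have := mulmx0_rank_max DN; move: xfree; rewrite /row_free => /eqP ->.
Qed.

Lemma has_dim_le_full S k : has_dim S k -> (k <= d)%N.
Proof.
by move=> /(@has_dim_le _ _ 1 0); rewrite mxrank0 addn0; apply => x y _ _; rewrite mulmx0.
Qed.

(** Small steps from [x] along the rows of [W] stay in the face: forms zero at [x] are constant in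
    these directions and the others keep their signs. *)
Lemma face_dim_ge H x k l (W : 'M[R]_(l, d)) :
  has_dim (face_at [set h | h \in H] x) k -> row_free W ->
  (forall h, h \in H -> hval h x = 0 -> W *m h.1^T = 0) -> (l <= k)%N.
Proof.
move=> [_ kmax] Wfree WH.
have [e e0 He] := small_sg [seq (hval h x, slope h.1 (row i W)) | h <- H, i <- enum 'I_l].
pose p (i : 'I_l.+1) : 'rV[R]_d :=
  if unlift ord0 i is Some j then x + e *: row j W else x.
apply: (kmax l p) => [i|].
  apply/face_atP => h Hh; rewrite /p; case: unliftP => [j _|//].
  rewrite hvalDZ; have [hx|hx] := eqVneq (hval h x) 0.
    suff -> : slope h.1 (row j W) = 0 by rewrite mulr0 addr0.
    by rewrite slopeE -row_mul WH // !mxE.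
  apply: (He e _ (hval h x, slope h.1 (row j W))) => //; first by rewrite (ltW e0) /=.
  by apply: (allpairs_f (fun h i => (hval h x, slope h.1 (row i W)))) => //; rewrite mem_enum.
rewrite /aff_indep (_ : \matrix_(i < l) _ = e *: W).
  by rewrite /row_free mxrank_scale_nz // gt_eqF.
by apply/row_matrixP => i; rewrite rowK /p liftK unlift_none linearZ /= addrC addKr.
Qed.

Lemma mxrank_row n : n != 0 -> \rank n = 1%N.
Proof. by rewrite rank_rV => ->. Qed.

End FaceDimension.

(** * Bounding the number of faces *)

Section FaceCount.
Local Open Scope classical_set_scope.
Variables (R : realType) (d : nat).
Implicit Types (h : hyperplane R d) (x y z v n : 'rV[R]_d).
Implicit Types (H : seq (hyperplane R d)).

(** Two points lie in the same face exactly when their sign vectors agree, so counting faces amounts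
    to counting sign vectors. *)
Definition sign_vector H x : seq R := [seq Num.sg (hval h x) | h <- H].

Lemma sign_vector_eq H x y : sign_vector H x = sign_vector H y <->
  forall h, h \in H -> Num.sg (hval h x) = Num.sg (hval h y).
Proof.
split=> [/eq_in_map //|Hxy].
by apply/eq_in_map => h; apply: Hxy.
Qed.

(** This is the convexity of faces. *)
Lemma sign_vector_segment H x y t : 0 <= t <= 1 ->
  sign_vector H x = sign_vector H y -> sign_vector H (x + t *: (y - x)) = sign_vector H x.
Proof.
move=> /andP [t0 t1] /sign_vector_eq Hxy; apply/sign_vector_eq => h hH.
rewrite hval_segment; move: (Hxy h hH).
case: (ltgtP (hval h x) 0) => [x0|x0|->]; case: (ltgtP (hval h y) 0) => [y0|y0|->];
   rewrite ?(ltr0_sg x0) ?(ltr0_sg y0) ?(gtr0_sg x0) ?(gtr0_sg y0) ?sgr0;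
   try (by move=> e; exfalso; lra).
- by move=> _; apply: ltr0_sg; nra.
- by move=> _; apply: gtr0_sg; nra.
- by rewrite !mulr0 addr0 sgr0.
Qed.

(* A hyperplane h cuts a face of the arrangement of H only if h meets that
   face, so adding h adds at most twice as many faces as there are on h, where
   the dimension has dropped by one. *)
Lemma sign_vectors_flat H x0 m (W : 'M[R]_(m, d)) :
  exists2 L : seq (seq R), (size L <= (2 * size H).+1 ^ \rank W)%N &
    forall x, (x - x0 <= W)%MS -> sign_vector H x \in L.
Proof.
elim: H x0 m W => [|h H IH] x0 m W.
  by exists [:: [::]] => //=; rewrite muln0 exp1n.
have [L Lsize LP] := IH x0 m W.
pose on s x := (x - x0 <= W)%MS /\ sign_vector H x = s.
(* A default sign of [h] among the points of the flat with signs [s]: negative if that occurs, else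
   positive if that occurs, else 0. By convexity, any other sign occurring there forces a zero of
   [h] in the same region. *)
pose ext s : R := if `[< exists2 x, on s x & hval h x < 0 >] then -1 else
                  if `[< exists2 x, on s x & 0 < hval h x >] then 1 else 0.
have extP x : (x - x0 <= W)%MS -> ext (sign_vector H x) = Num.sg (hval h x) \/
    [/\ Num.sg (hval h x) = 0 \/ Num.sg (hval h x) = 1 & exists z,
      [/\ (z - x0 <= W)%MS, hval h z = 0 & sign_vector H z = sign_vector H x]].
  move=> xW; rewrite /ext; case: asboolP => [[y [yW yx] y0]|nneg].
    case: (ltgtP (hval h x) 0) => [x0'|x0'|x0']; first by rewrite ltr0_sg //; left.
      right; split; first by right; rewrite gtr0_sg.
      have [t [t01 ht]] : exists t, 0 <= t <= 1 /\ (1 - t) * hval h x + t * hval h y = 0.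
        have xy : 0 < hval h x - hval h y by lra.
        exists (hval h x / (hval h x - hval h y)); split.
          by apply/andP; split; [apply: divr_ge0; lra | rewrite ler_pdivrMr //; lra].
        by field; rewrite gt_eqF.
      exists (x + t *: (y - x)); split; last by rewrite sign_vector_segment.
        have -> : x + t *: (y - x) - x0 = (1 - t) *: (x - x0) + t *: (y - x0).
          apply/rowP => i; rewrite !mxE; ring.
        by rewrite addmx_sub ?scalemx_sub.
      by rewrite hval_segment.
    right; split; first by left; rewrite x0' sgr0.
    by exists x; split.
  case: asboolP => [[y [yW yx] y0]|npos].
    case: (ltgtP (hval h x) 0) => [x0'|x0'|x0']; first by case: nneg; exists x.
      by left; rewrite gtr0_sg.
    right; split; first by left; rewrite x0' sgr0.
    by exists x; split.
  left; case: (ltgtP (hval h x) 0) => [x0'|x0'|x0']; last by rewrite x0' sgr0.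
    by case: nneg; exists x.
  by case: npos; exists x.
pose L0 := [seq ext s :: s | s <- L].
have L0P x : (x - x0 <= W)%MS -> ext (sign_vector H x) = Num.sg (hval h x) ->
    sign_vector (h :: H) x \in L0.
  by move=> xW ex; apply/mapP; exists (sign_vector H x); rewrite ?LP // ex.
have le_exp : ((2 * size H).+1 ^ \rank W <= (2 * size (h :: H)).+1 ^ \rank W)%N.
  by case: (\rank W) => // r; rewrite leq_exp2r //=; lia.
have L0size : (size L0 <= (2 * size H).+1 ^ \rank W)%N by rewrite size_map.
(* A form constant on the flat takes one sign there, hence adds no sign vector. *)
have [hW|hW] := eqVneq (W *m h.1^T) 0.
  exists L0; first exact: leq_trans le_exp.
  move=> x xW; apply: L0P => //.
  have hconst z : (z - x0 <= W)%MS -> hval h z = hval h x0.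
    move=> /submxP [D zD]; have -> : z = x0 + 1 *: (z - x0) by rewrite scale1r addrC subrK.
    by rewrite hvalDZ slopeE zD -mulmxA hW mulmx0 mxE mulr0 addr0.
  rewrite hconst // /ext; case: asboolP => [[y [yW _]]|nneg].
    by rewrite hconst // => /ltr0_sg.
  case: asboolP => [[y [yW _]]|npos]; first by rewrite hconst // => /gtr0_sg.
  case: (ltgtP (hval h x0) 0) => [x0'|x0'|->]; last by rewrite sgr0.
    by case: nneg; exists x; rewrite ?hconst.
  by case: npos; exists x; rewrite ?hconst.
have [[x1 x1W x1h]|none] := pselect (exists2 x1, (x1 - x0 <= W)%MS & hval h x1 = 0);
  last first.
  exists L0; first exact: leq_trans le_exp.
  move=> x xW; apply: L0P => //; have [//|[_ [z [zW zh _]]]] := extP x xW.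
  by case: none; exists z.
(* The flat where [h] vanishes runs through [x1] and has smaller dimension. Only regions that meet
   it acquire signs beyond the default one, and these are 0 and 1. *)
have [Lh Lhsize LhP] := IH x1 d (W :&: kermx h.1^T)%MS.
exists (L0 ++ [seq 0 :: s | s <- Lh] ++ [seq 1 :: s | s <- Lh]).
  rewrite !size_cat !size_map.
  have : (\rank (W :&: kermx h.1^T)%MS < \rank W)%N.
    apply: rank_ltmx; rewrite /ltmx capmxSl /=; apply: contra hW => Wsub.
    by apply/eqP/sub_kermxP; apply: submx_trans Wsub (capmxSr _ _).
  move: Lsize Lhsize; case: (\rank W) => // r; move: (\rank _) => r' Ls Lhs; rewrite ltnS => rr'.
  have {}Lhs : (size Lh <= (2 * size H).+1 ^ r)%N.
    by apply: leq_trans Lhs _; rewrite leq_pexp2l.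
  have : ((2 * size H).+1 ^ r <= (2 * size (h :: H)).+1 ^ r)%N.
    by case: (r) => // r0; rewrite leq_exp2r //=; lia.
  rewrite !expnS /= in Ls *.
  (* With q = [size H], (2q+1)^(r+1) + 2(2q+1)^r = (2q+3)(2q+1)^r, which is at most (2q+3)^(r+1). *)
  set u := (_ ^ r)%N in Ls Lhs *; set u' := (_ ^ r)%N; nia.
move=> x xW; rewrite mem_cat; have [/(L0P x xW) -> //|] := extP x xW.
move=> [hx [z [zW zh zx]]]; have xLh : sign_vector H x \in Lh.
  rewrite -zx; apply: LhP; rewrite sub_capmx; apply/andP; split.
    have -> : z - x1 = (z - x0) - (x1 - x0) by rewrite opprB addrA subrK.
    by rewrite addmx_sub // eqmx_opp.
  apply/sub_kermxP; apply/rowP => i; rewrite ord1 -slopeE slopeB mxE.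
  by move: zh x1h; rewrite !hvalE; lra.
rewrite mem_cat; case: hx => hx; apply/orP; right; apply/orP; [left|right];
  by apply/mapP; exists (sign_vector H x) => //=; rewrite hx.
Qed.

Lemma sign_vectors H :
  exists2 L : seq (seq R), (size L <= (2 * size H).+1 ^ d)%N &
    forall x, sign_vector H x \in L.
Proof.
have [L Lsize LP] := sign_vectors_flat H 0 (1%:M : 'M[R]_d).
by exists L => [|x]; [rewrite mxrank1 in Lsize | apply: LP; apply: submx1].
Qed.

End FaceCount.

(** * Cells and facets of a computed arrangement *)

Section RepresentedArrangement.
Local Open Scope classical_set_scope.
Variables (R : realType) (d : nat) (H : seq (hyperplane R d)).
Variables (A : arrangement R d).
Hypotheses (d_gt0 : (0 < d)%N) (Hprop : proper_input H) (Hrep : represents H A).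
Implicit Types (h : hyperplane R d) (x y z v n : 'rV[R]_d).
Implicit Types (k l g c : 'I_(nfaces A)).

Local Notation F := (@node_face R d [set h | h \in H] A).
Local Notation sg h x := (Num.sg (hval h x)).

Lemma node_faceP k x : F k x <-> forall h, h \in H -> sg h x = sg h (fpt A k).
Proof. exact: face_atP. Qed.

Lemma node_face_fpt k : F k (fpt A k).
Proof. exact/node_faceP. Qed.

Lemma node_eq k l :
  (forall h, h \in H -> sg h (fpt A k) = sg h (fpt A l)) -> k = l.
Proof.
move=> kl; have [[Finj _] _ _ _ _] := Hrep; apply: Finj.
by apply/seteqP; split=> x /node_faceP xk; apply/node_faceP => h hH; rewrite xk // kl.
Qed.

Lemma node_at x : exists k, forall h, h \in H -> sg h (fpt A k) = sg h x.
Proof.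
have [[_ Fex] _ _ _ _] := Hrep.
have : is_face [set h | h \in H] (face_at [set h | h \in H] x).
  by split; [exists x; apply/face_atP | exists (fun h => side h x)].
by move/Fex => [k kx]; exists k => h hH; have := node_face_fpt k; rewrite -kx => /face_atP ->.
Qed.

Lemma normal_neq0 h : h \in H -> h.1 != 0.
Proof. by case: Hprop => _ + _; apply. Qed.

Lemma hyperplane_neq0 h : h \in H -> h != 0.
Proof. by move=> /normal_neq0; apply: contra => /eqP ->. Qed.

(** Differences of points of the face are annihilated by the nonzero normal of [h], which costs one
    dimension. *)
Lemma fdim_on k h : h \in H -> hval h (fpt A k) = 0 -> (fdim A k < d)%N.
Proof.
move=> hH hk; have [_ Fdim _ _ _] := Hrep.
have := @has_dim_le _ _ _ _ _ (h.1^T) (Fdim k).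
rewrite mxrank_tr mxrank_row ?normal_neq0 // addn1; apply => x y /node_faceP xk /node_faceP yk.
have Fk0 z : sg h z = sg h (fpt A k) -> hval h z = 0.
  by rewrite hk sgr0 => /eqP; rewrite sgr_eq0 => /eqP.
apply/rowP => i; rewrite ord1 -slopeE slopeB mxE.
by have := Fk0 x (xk h hH); have := Fk0 y (yk h hH); rewrite !hvalE; lra.
Qed.

(** Off all hyperplanes every direction is admissible in [face_dim_ge]; on a hyperplane a dimension
    is lost. *)
Lemma cellP k : fdim A k = d <-> forall h, h \in H -> hval h (fpt A k) != 0.
Proof.
split=> [kd h hH|kH].
  by apply/eqP => /(fdim_on hH); rewrite kd ltnn.
have [_ Fdim _ _ _] := Hrep; apply/eqP; rewrite eqn_leq (has_dim_le_full (Fdim k)) /=.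
apply: (face_dim_ge (W := 1%:M) (Fdim k)); first by rewrite /row_free mxrank1.
by move=> h /kH /eqP.
Qed.

(** The directions parallel to [h] are all admissible and form a space of dimension [d.-1]. *)
Lemma facet_of_single k h : h \in H -> hval h (fpt A k) = 0 ->
  (forall h', h' \in H -> h' != h -> hval h' (fpt A k) != 0) -> fdim A k = d.-1.
Proof.
move=> hH hk kH; have [_ Fdim _ _ _] := Hrep.
apply/eqP; rewrite eqn_leq; apply/andP; split; first by rewrite -ltnS prednK // (fdim_on hH).
have rk : (\rank (kermx h.1^T) = d.-1)%N.
  by rewrite mxrank_ker mxrank_tr mxrank_row ?normal_neq0 // subn1.
rewrite -rk; apply: (face_dim_ge (W := row_base (kermx h.1^T)) (Fdim k)).
  exact: row_base_free.
move=> h' h'H h'k; have [->|/(kH _ h'H)] := eqVneq h' h; last by rewrite h'k eqxx.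
by apply/sub_kermxP; rewrite eq_row_base.
Qed.

(** Two normals annihilating a face of dimension [d.-1] are proportional. Both forms vanish on the
    face, so they are proportional as well; the hyperplanes are then one set and, by [proper_input],
    one encoding. *)
Lemma facet_single k h h' : fdim A k = d.-1 -> h \in H -> h' \in H ->
  hval h (fpt A k) = 0 -> hval h' (fpt A k) = 0 -> h = h'.
Proof.
move=> kd hH h'H hk h'k; have [_ Fdim _ _ _] := Hrep.
have Fk0 x : F k x -> hval h x = 0 /\ hval h' x = 0.
  move=> /node_faceP xk; split; apply/eqP; rewrite -sgr_eq0 xk // ?hk ?h'k sgr0 //.
have : (fdim A k + \rank (col_mx h.1 h'.1)^T <= d)%N.
  apply: (has_dim_le (Fdim k)) => x y /Fk0 [hx h'x] /Fk0 [hy h'y]; rewrite tr_col_mx mul_mx_row.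
  apply/rowP => i; rewrite !mxE; case: splitP => j _; rewrite ord1 -slopeE slopeB;
    move: hx h'x hy h'y; rewrite !hvalE; lra.
rewrite mxrank_tr kd => rk; have {}rk : (\rank (col_mx h.1 h'.1) <= \rank h.1)%N.
  by rewrite mxrank_row ?normal_neq0 //; lia.
have h1sub : (h.1 <= col_mx h.1 h'.1)%MS by rewrite -addsmxE addsmxSl.
have : (col_mx h.1 h'.1 <= h.1)%MS.
  by have := mxrank_leqif_sup h1sub; move=> /geq_leqif <-.
rewrite col_mx_sub => /andP [_ /submxP [D h'D]].
have hh' x : hval h' x = D 0 0 * hval h x.
  have xz : x = fpt A k + 1 *: (x - fpt A k) by rewrite scale1r addrC subrK.
  rewrite xz !hvalDZ hk h'k !add0r !mul1r h'D /slope mulr_sumr; apply: eq_bigr => i _.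
  by rewrite mxE big_ord1 mulrA.
have D0 : D 0 0 != 0.
  apply: contraNneq (normal_neq0 h'H) => D0.
  by rewrite h'D; apply/eqP/rowP => i; rewrite !mxE big_ord1 D0 mul0r.
case: Hprop => _ _; apply => //; apply/seteqP.
by split=> x /side_Eq hx; apply/side_Eq; move: hx; rewrite hh' => /eqP;
  rewrite ?mulf_eq0 ?(negPf D0) => /eqP // ->; rewrite mulr0.
Qed.

Lemma facet_hyperplane k : fdim A k = d.-1 -> exists i h,
  [/\ fhyp A k = Some i, onth H i = Some h, h \in H, hval h (fpt A k) = 0 &
      forall h', h' \in H -> h' != h -> hval h' (fpt A k) != 0].
Proof.
move=> kd; have [_ _ _ _ /(_ k kd) [i [h [ki hi /(_ _ (node_face_fpt k)) /side_Eq hk]]]] := Hrep.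
have hH : h \in H by apply/onthP; exists i.
exists i, h; split=> // h' h'H; apply: contraNneq => h'k.
by apply/eqP; apply: (facet_single kd).
Qed.

(** This replaces topological incidence by signs. Strict signs on a cell persist weakly on its
    closure; conversely, a short step in the direction from the stored point of the facet to that of
    the cell leads from any point of the facet into the cell. *)
Lemma cell_of_facet g c : fdim A g = d.-1 ->
  c \in fups A g <-> (forall h, h \in H -> hval h (fpt A c) != 0) /\
    (forall h, h \in H -> hval h (fpt A g) != 0 -> sg h (fpt A c) = sg h (fpt A g)).
Proof.
move=> gd; have [_ _ _ Fups _] := Hrep; rewrite Fups gd prednK //; split.
  move=> [cd gc]; split=> [|h hH hg]; first exact/cellP.
  have /cellP /(_ h hH) hc := cd.
  have gcl := gc _ (node_face_fpt g).
  have hF x : F c x -> sg h x = sg h (fpt A c) by move=> /node_faceP ->.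
  case: (ltgtP (hval h (fpt A c)) 0) hc => // hc _; rewrite ?(gtr0_sg hc) ?(ltr0_sg hc).
    suff : 0 <= hval (- h.1, - h.2) (fpt A g).
      rewrite hvalN oppr_ge0 le_eqVlt (negPf hg) /= => /ltr0_sg -> //.
    apply: closure_hval_ge0 gcl _ => y /hF; rewrite hvalN oppr_ge0 (ltr0_sg hc) => /eqP.
    by rewrite sgr_cp0 => /ltW.
  suff : 0 <= hval h (fpt A g) by rewrite le_eqVlt eq_sym (negPf hg) /= => /gtr0_sg ->.
  apply: closure_hval_ge0 gcl _ => y /hF; rewrite (gtr0_sg hc) => /eqP.
  by rewrite sgr_cp0 => /ltW.
move=> [cH cg]; split; first exact/cellP.
have [i [h0 [_ _ h0H h0g gH]]] := facet_hyperplane gd.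
move=> x /node_faceP xg; have [e e0 He] := small_step H x (fpt A c - fpt A g).
apply: (closure_ray e0 (v := fpt A c - fpt A g)) => t /andP [t0 te].
apply/node_faceP => h hH; have [->|hh0] := eqVneq h h0.
  have h0x : hval h0 x = 0 by apply/eqP; rewrite -sgr_eq0 xg // h0g sgr0.
  rewrite hvalDZ slopeB h0x add0r.
  have -> : slope h0.1 (fpt A c) - slope h0.1 (fpt A g) = hval h0 (fpt A c).
    by move: h0g; rewrite !hvalE; lra.
  by rewrite sgrM (gtr0_sg t0) mul1r.
have hx : hval h x != 0 by rewrite -sgr_eq0 xg // sgr_eq0 gH.
by rewrite He // ?(ltW t0) // xg // cg ?gH.
Qed.

(** Cells around a facet have equal signs at all other hyperplanes, so distinct ones differ at [h],
    where neither sign is zero. *)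
Lemma facet_sides g c c' h : fdim A g = d.-1 -> c \in fups A g -> c' \in fups A g ->
  h \in H -> hval h (fpt A g) = 0 -> c != c' -> sg h (fpt A c) = - sg h (fpt A c').
Proof.
move=> gd /(cell_of_facet _ gd) [cH cg] /(cell_of_facet _ gd) [c'H c'g] hH hg cc'.
have [i [h0 [_ _ h0H h0g gH]]] := facet_hyperplane gd.
have hh0 : h = h0 by apply: (facet_single gd).
rewrite {}hh0 in hH hg *.
have : sg h0 (fpt A c) != sg h0 (fpt A c').
  apply: contra cc' => /eqP hcc'; apply/eqP/node_eq => h' h'H.
  by have [->//|h'h0] := eqVneq h' h0; rewrite cg ?c'g ?gH.
move: (cH h0 hH) (c'H h0 hH).
case: (ltgtP (hval h0 (fpt A c)) 0) => // hc _;
  case: (ltgtP (hval h0 (fpt A c')) 0) => // hc' _;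
  by rewrite ?(gtr0_sg hc) ?(ltr0_sg hc) ?(gtr0_sg hc') ?(ltr0_sg hc') ?eqxx ?opprK.
Qed.

(** Three cells would have pairwise opposite nonzero signs at the hyperplane of the facet. *)
Lemma size_fups g : fdim A g = d.-1 -> (size (fups A g) <= 2)%N.
Proof.
move=> gd; have [_ _ /(_ g) + _ _] := Hrep; case def_f: (fups A g) => [|c1 [|c2 [|c3 s]]] //=.
rewrite !inE !negb_or => /andP [/and3P [c12 c13 _] /andP [/andP [c23 _] _]].
have [i [h [_ _ hH hg gH]]] := facet_hyperplane gd.
have sides c c' : c \in [:: c1; c2; c3] -> c' \in [:: c1; c2; c3] -> c != c' ->
    sg h (fpt A c) = - sg h (fpt A c').
  move=> cf c'f; apply: (facet_sides gd) => //;
    by rewrite def_f -[_ :: _]/([:: c1; c2; c3] ++ s) mem_cat ?cf ?c'f.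
have c3g : c3 \in fups A g by rewrite def_f !inE eqxx !orbT.
have /(cell_of_facet _ gd) [/(_ h hH) c3h _] := c3g.
have := sides c1 c2; have := sides c1 c3; have := sides c2 c3.
rewrite !inE !eqxx !orbT => /(_ isT isT c23) -> /(_ isT isT c13) -> /(_ isT isT c12).
rewrite opprK => /eqP; rewrite eq_sym -addr_eq0 -mulr2n mulrn_eq0 /= sgr_eq0 (negPf c3h) //.
Qed.

(** A short generic step leads from any point into a cell, and the way there stays in that cell. *)
Lemma cells_cover x : exists2 c, fdim A c = d & closure (F c) x.
Proof.
have [v [e e0 He]] := generic_step H x.
have [c cP] := node_at (x + e *: v).
have cH h : h \in H -> hval h (fpt A c) != 0.
  move=> hH; rewrite -sgr_eq0 cP // sgr_eq0.
  have [_] := He e (introT andP (conj e0 (lexx e))) h hH.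
  by apply; apply: hyperplane_neq0.
exists c; first exact/cellP.
apply: (closure_ray (v := v) e0) => t /[dup] te /andP [t0 le_te].
apply/node_faceP => h hH; rewrite cP //.
have [Ht1 Ht2] := He t te h hH; have [He1 He2] := He e (introT andP (conj e0 (lexx e))) h hH.
have [hx|hx] := eqVneq (hval h x) 0; last by rewrite Ht1 // He1.
by rewrite !hvalDZ hx !add0r !sgrM (gtr0_sg t0) (gtr0_sg e0).
Qed.

(** Cells are open. An interior point of [S] is approached by [F c] within [S]; the point of [F c]
    found there is in turn approached by [F c'], so the two cells meet. *)
Lemma cells_overlap c c' (S : set 'rV[R]_d) : fdim A c = d -> fdim A c' = d ->
  S `<=` closure (F c) `&` closure (F c') -> interior S !=set0 -> c = c'.
Proof.
move=> cd c'd SF [x Sx].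
have cell_open k : fdim A k = d -> forall y, F k y -> nbhs y (F k).
  move=> kd y /node_faceP yk.
  have /cellP kH := kd.
  have : \forall z \near y, forall h, h \in H -> sg h z = sg h (fpt A k).
    have Hsub : {subset H <= H} by [].
    (* The induction runs over sublists of [H], while the stored signs remain those of the whole
       arrangement. *)
    elim: {-2}H Hsub => [|h H' IH] HH'; first by near=> z.
    have hH : h \in H by apply: HH'; rewrite inE eqxx.
    have : \forall z \near y, sg h z = sg h (fpt A k).
      have hcont : hval h z @[z --> y] --> hval h y := @hval_continuous _ _ h y.
      have hy := yk h hH; have hk := kH h hH.
      case: (ltgtP (hval h y) 0) => y0.
      - by apply: filterS (cvgr_lt _ hcont _ y0) => z z0; rewrite -hy !ltr0_sg.
      - by apply: filterS (cvgr_gt _ hcont _ y0) => z z0; rewrite -hy !gtr0_sg.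
      - by move: hy hk; rewrite y0 sgr0 => /esym/eqP; rewrite sgr_eq0 => ->.
    have := IH (fun h' h'H => HH' h' (mem_behead (s := h :: H') h'H)).
    apply: filterS2 => z zH' zh h'; rewrite inE => /orP [/eqP ->|] //; exact: zH'.
  by apply: filterS => z zH; apply/node_faceP.
have [y [Fy Sy]] : F c `&` S !=set0 by case: (SF _ (nbhs_singleton Sx)) => + _; apply.
have Ny := cell_open c cd y Fy.
have [z [/node_faceP zc' /node_faceP zc]] : F c' `&` F c !=set0.
  by case: (SF _ Sy) => _; apply.
by apply: node_eq => h hH; rewrite -zc // zc'.
Unshelve. all: end_near.
Qed.

(** A face is identified by the position of its sign vector in the list from [sign_vectors]. *)
Lemma nfaces_le : (nfaces A <= (2 * size H).+1 ^ d)%N.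
Proof.
have [L Lsize LP] := sign_vectors H; apply: leq_trans Lsize.
have lt k : (index (sign_vector H (fpt A k)) L < size L)%N by rewrite index_mem.
have inj : injective (fun k => Ordinal (lt k)).
  move=> k l [] kl; apply: node_eq; apply/sign_vector_eq.
  by rewrite -(nth_index [::] (LP (fpt A k))) kl nth_index.
by have := leq_card _ inj; rewrite !card_ord.
Qed.

End RepresentedArrangement.

Lemma seq_argmin (T : eqType) (R : realDomainType) (f : T -> R) (s : seq T) (x0 : T) :
  x0 \in s -> exists2 x, x \in s & forall y, y \in s -> f x <= f y.
Proof.
elim: s x0 => // a [|b s] IH x0 _.
  by exists a; rewrite ?inE // => y; rewrite inE => /eqP ->.
have [x xs xmin] := IH b (mem_head _ _).
have [ax|xa] := leP (f a) (f x).
  exists a; first exact: mem_head.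
  by move=> y; rewrite in_cons => /orP [/eqP -> //|/xmin /(le_trans ax)].
exists x; first by rewrite in_cons xs orbT.
by move=> y; rewrite in_cons => /orP [/eqP ->|/xmin //]; apply: ltW.
Qed.

(** * Paths from cell to cell *)

Section Crossing.
Local Open Scope classical_set_scope.
Variables (R : realType) (d : nat) (H : seq (hyperplane R d)).
Hypothesis (Hprop : proper_input H).
Implicit Types (h : hyperplane R d) (x y z v n w : 'rV[R]_d).
Local Notation sg h x := (Num.sg (hval h x)).

(* This form vanishes at x if and only if the line from x to y meets h and h'
   in the same point. *)
Definition tie_form y h h' : hyperplane R d :=
  (hval h' y *: h.1 - hval h y *: h'.1, hval h' y * h.2 - hval h y * h'.2).

Lemma hval_tie_form x y h h' :
  hval (tie_form y h h') x = hval h' y * hval h x - hval h y * hval h' x.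
Proof.
rewrite !(hvalE _ x) /=.
have -> : slope (hval h' y *: h.1 - hval h y *: h'.1) x =
    hval h' y * slope h.1 x - hval h y * slope h'.1 x.
  rewrite /slope !mulr_sumr -sumrB; apply: eq_bigr => i _; rewrite !mxE; ring.
ring.
Qed.

Lemma tie_form_neq0 y h h' : h \in H -> h' \in H -> hval h y != 0 -> hval h' y != 0 ->
  h' != h -> tie_form y h h' != 0.
Proof.
move=> hH h'H hy h'y; apply: contra => /eqP tie0; apply/eqP.
case: Hprop => _ _; apply => //.
have eq x : hval h' y * hval h x = hval h y * hval h' x.
  apply/eqP; rewrite -subr_eq0 -hval_tie_form tie0 hvalE /slope big1 ?add0r // => i _.
  by rewrite mxE mul0r.
apply/seteqP; split=> x /side_Eq hx; apply/side_Eq; apply/eqP; have /eqP := eq x;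
  by rewrite hx mulr0 ?[0 == _]eq_sym mulf_eq0 ?(negPf hy) ?(negPf h'y).
Qed.

(** [z] is where the segment from a perturbation of [x] to [y] first meets a hyperplane, and [w]
    lies just behind it. Thus [z] belongs to a facet and [w] to the next cell. *)
Lemma first_crossing x y :
  (forall h, h \in H -> hval h x != 0) -> (forall h, h \in H -> hval h y != 0) ->
  (exists2 h, h \in H & sg h x != sg h y) ->
  exists h z w, [/\ h \in H /\ sg h x != sg h y, hval h z = 0, sg h w = sg h y &
    forall h', h' \in H -> h' != h ->
      [/\ hval h' z != 0, sg h' z = sg h' x & sg h' w = sg h' x]].
Proof.
move=> xH yH [h0 h0H h0xy].
(* Tie forms that are nonzero at [x'] ensure that no two hyperplanes are met at the same time on the
   way to [y]. *)
have [v [e e0 /(_ e)]] := generic_step (H ++ [seq tie_form y h h' | h <- H, h' <- H]) x.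
rewrite e0 lexx => /(_ isT) He; set x' := x + e *: v in He.
have x'x h : h \in H -> sg h x' = sg h x.
  by move=> hH; have [|-> //] := He h; [rewrite mem_cat hH | apply: xH].
have x'H h : h \in H -> hval h x' != 0 by move=> hH; rewrite -sgr_eq0 x'x // sgr_eq0 xH.
have no_tie h h' : h \in H -> h' \in H -> h' != h ->
    hval h' y * hval h x' - hval h y * hval h' x' != 0.
  move=> hH h'H hh'; rewrite -hval_tie_form.
  have [|_ ->//] := He (tie_form y h h'); last by rewrite tie_form_neq0 ?yH.
  by rewrite mem_cat; apply/orP; right; apply: (allpairs_f (tie_form y)).
(* The time at which the segment from [x'] to [y] meets [h], since [hval h] is affine along it. *)
pose tau h := hval h x' / (hval h x' - hval h y).
have h0S : h0 \in [seq h <- H | sg h x != sg h y] by rewrite mem_filter h0xy.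
have [h] := seq_argmin tau h0S.
rewrite mem_filter => /andP [hxy hH] hmin.
have opp h' : h' \in H -> sg h' x != sg h' y ->
    hval h' x' < 0 < hval h' y \/ hval h' y < 0 < hval h' x'.
  move=> h'H; rewrite -x'x //; move: (x'H h' h'H) (yH h' h'H).
  case: (ltgtP (hval h' x') 0) => // a0 _; case: (ltgtP (hval h' y) 0) => // b0 _;
    rewrite ?(gtr0_sg a0) ?(ltr0_sg a0) ?(gtr0_sg b0) ?(ltr0_sg b0) ?eqxx //; by [left|right].
have mono (a b t : R) : a < 0 < b \/ b < 0 < a -> 0 < t -> Num.sg (t * (a - b)) = Num.sg a.
  move=> ab t0; rewrite sgrM (gtr0_sg t0) mul1r.
  by case: ab => /andP [u0 v0]; [rewrite !ltr0_sg | rewrite !gtr0_sg]; lra.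
have tauE h' : h' \in H -> sg h' x != sg h' y -> tau h' * (hval h' x' - hval h' y) = hval h' x'.
  move=> h'H /(opp h' h'H) ab; rewrite /tau divfK //.
  by case: ab => /andP [u0 v0]; apply/eqP => ?; lra.
have tauP h' : h' \in H -> sg h' x != sg h' y -> 0 < tau h' < 1.
  move=> h'H /[dup] /(tauE h' h'H) tE /(opp h' h'H) ab; apply/andP.
  by case: ab => /andP [u0 v0]; split; rewrite ltNge; apply/negP => ?; nra.
set z := x' + tau h *: (y - x').
have zE h' : hval h' z = (1 - tau h) * hval h' x' + tau h * hval h' y by rewrite hval_segment.
have /andP [t0 t1] := tauP h hH hxy.
have zh : hval h z = 0 by rewrite zE; have := tauE h hH hxy; lra.
have zH h' : h' \in H -> h' != h -> sg h' z = sg h' x.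
  move=> h'H h'h; rewrite zE -x'x //.
  (* A hyperplane with both ends on one side is not met at all. *)
  have [h'xy|h'xy] := eqVneq (sg h' x) (sg h' y).
    move: h'xy; rewrite -x'x //; move: (x'H h' h'H) (yH h' h'H).
    case: (ltgtP (hval h' x') 0) => // a0 _; case: (ltgtP (hval h' y) 0) => // b0 _;
      rewrite ?(gtr0_sg a0) ?(ltr0_sg a0) ?(gtr0_sg b0) ?(ltr0_sg b0) => s; try (exfalso; lra).
      by rewrite ltr0_sg //; nra.
    by rewrite gtr0_sg //; nra.
  (* A hyperplane between the ends is met strictly later than [h]: equal times would make the tie
     form vanish at [x']. *)
  have lt_tau : tau h < tau h'.
    rewrite lt_neqAle hmin ?mem_filter ?h'xy // andbT.
    apply: contra (no_tie h h' hH h'H h'h) => /eqP tt.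
    have E1 := tauE h hH hxy; have E2 := tauE h' h'H h'xy; rewrite -tt in E2.
    have := congr1 ( *%R^~ (hval h' x' - hval h' y)) E1.
    have := congr1 ( *%R^~ (hval h x' - hval h y)) E2.
    by move=> /= E3 E4; apply/eqP; lra.
  have -> : (1 - tau h) * hval h' x' + tau h * hval h' y =
      (tau h' - tau h) * (hval h' x' - hval h' y).
    by have := tauE h' h'H h'xy; lra.
  by apply: mono; [apply: opp | rewrite subr_gt0].
have [e1 e10 He1] := small_step H z (y - z).
have e1e1 : 0 <= e1 <= e1 by rewrite (ltW e10) lexx.
exists h, z, (z + e1 *: (y - z)); split=> //.
  by rewrite hval_segment zh mulr0 add0r sgrM (gtr0_sg e10) mul1r.
move=> h' h'H h'h; have h'z : hval h' z != 0 by rewrite -sgr_eq0 zH // sgr_eq0 xH.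
by split; rewrite ?He1 ?zH.
Qed.

End Crossing.

Section Connectivity.
Local Open Scope classical_set_scope.
Variables (R : realType) (d : nat) (H : seq (hyperplane R d)).
Variables (A : arrangement R d).
Hypotheses (d_gt0 : (0 < d)%N) (Hprop : proper_input H) (Hrep : represents H A).

(** Induction on the number of hyperplanes between the current cell and [c]: crossing the facet
    given by [first_crossing] removes exactly one of them. *)
Lemma cells_connected (V : 'I_(nfaces A) -> Prop) (c0 c : 'I_(nfaces A)) :
  fdim A c0 = d -> fdim A c = d -> V c0 ->
  (forall g c1 c2, fdim A g = d.-1 -> c1 \in fups A g -> c2 \in fups A g -> V c1 -> V c2) ->
  V c.
Proof.
move=> c0d cd Vc0 Vadj; have cellE k := cellP Hprop Hrep k.
have /cellE cH := cd.
pose dist k := count (fun h => Num.sg (hval h (fpt A k)) != Num.sg (hval h (fpt A c))) H.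
have [n] := ubnP (dist c0); elim: n c0 c0d Vc0 => // n IH k kd Vk kn.
have /cellE kH := kd.
have [[h hH hkc]|same] := pselect (exists2 h, h \in H &
  Num.sg (hval h (fpt A k)) != Num.sg (hval h (fpt A c))); last first.
  suff -> : c = k by [].
  apply: (node_eq Hrep) => h hH; apply/esym/eqP/negPn/negP => hkc.
  by case: same; exists h.
have [{hH hkc}h [z [w [[hH hkc] zh wh zH]]]] := first_crossing Hprop kH cH (ex_intro2 _ _ h hH hkc).
have [g gz] := node_at Hrep z; have [c' c'w] := node_at Hrep w.
have gh : hval h (fpt A g) = 0 by apply/eqP; rewrite -sgr_eq0 gz // zh sgr0.
have gH h' : h' \in H -> h' != h -> hval h' (fpt A g) != 0.
  by move=> h'H h'h; rewrite -sgr_eq0 gz // sgr_eq0; have [] := zH h' h'H h'h.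
have gd : fdim A g = d.-1 := facet_of_single d_gt0 Hprop Hrep hH gh gH.
have c'H h' : h' \in H -> hval h' (fpt A c') != 0.
  move=> h'H; rewrite -sgr_eq0 c'w //; have [->|h'h] := eqVneq h' h.
    by rewrite wh sgr_eq0 cH.
  by have [_ _ ->] := zH h' h'H h'h; rewrite sgr_eq0 kH.
have adj c1 : (forall h', h' \in H -> hval h' (fpt A c1) != 0) ->
    (forall h', h' \in H -> h' != h -> Num.sg (hval h' (fpt A c1)) = Num.sg (hval h' (fpt A k))) ->
    c1 \in fups A g.
  move=> c1H c1k; apply/(cell_of_facet d_gt0 Hprop Hrep _ gd); split=> // h' h'H h'g.
  have h'h : h' != h by apply: contraNneq h'g => ->; rewrite gh.
  by rewrite c1k // gz //; have [_ -> _] := zH h' h'H h'h.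
have c'k h' : h' \in H -> h' != h -> Num.sg (hval h' (fpt A c')) = Num.sg (hval h' (fpt A k)).
  by move=> h'H h'h; rewrite c'w //; have [_ _ ->] := zH h' h'H h'h.
apply: (IH c'); first exact/cellE.
  by apply: (Vadj g k c') => //; apply: adj.
rewrite -ltnS; apply: leq_trans kn; rewrite ltnS /dist.
have [Hu _ _] := Hprop.
have cnt k' : count (fun h' => Num.sg (hval h' (fpt A k')) != Num.sg (hval h' (fpt A c))) H =
    ((Num.sg (hval h (fpt A k')) != Num.sg (hval h (fpt A c))) +
     count (fun h' => Num.sg (hval h' (fpt A k')) != Num.sg (hval h' (fpt A c))) (rem h H))%N.
  by rewrite (permP (perm_to_rem hH)).
rewrite !cnt c'w // wh eqxx hkc ltnS; apply/eq_leq/eq_in_count => h' .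
by rewrite (rem_filter _ Hu) mem_filter => /andP [/= h'h h'H]; rewrite c'k.
Qed.

End Connectivity.

(** * Separating hyperplanes *)

Section SeparatingHyperplanes.
Local Open Scope classical_set_scope.
Variables (R : realType) (p : nat) (E : finType) (M : matroid E).
Variables (a : E -> rat) (b : 'I_p -> E -> rat).
Implicit Types (e f g : E) (x y z : 'rV[R]_p) (B : {set E}).

Local Notation w := (weight a b).
Local Notation hyp := (sep_hyp R a b).
Local Notation sg e f x := (Num.sg (hval (hyp e f) x)).

Lemma hval_sep e f x : hval (hyp e f) x = w e x - w f x.
Proof.
rewrite /hval /weight /= opprD addrACA -sumrB addrC; congr (_ + _).
by apply: eq_bigr => i _; rewrite mxE mulrC mulrBr.
Qed.

(** Reversed, since the loops of [compute_sep] put each new entry in front of the earlier ones. *)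
Definition sep_list : seq ((E * E) * hyperplane R p) :=
  rev [seq ((e, f), hyp e f) | e <- enum E,
         f <- [seq f <- enum E | (enum_rank e < enum_rank f)%N]].

Lemma mem_sep_list efh : efh \in sep_list <->
  (enum_rank efh.1.1 < enum_rank efh.1.2)%N /\ efh.2 = hyp efh.1.1 efh.1.2.
Proof.
rewrite mem_rev; split.
  move=> /allpairsPdep [e [f [_]]]; rewrite mem_filter => /andP [ef _] -> //.
case: efh => [[e f] h] /= [ef ->]; apply/allpairsPdep; exists e, f; split=> //.
  by rewrite mem_enum.
by rewrite mem_filter ef mem_enum.
Qed.

Lemma uniq_unzip1_sep_list : uniq (unzip1 sep_list).
Proof.
rewrite /unzip1 /sep_list map_rev rev_uniq map_allpairs /=; apply: allpairs_uniq_dep.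
- exact: enum_uniq.
- by move=> e _; rewrite filter_uniq // enum_uniq.
- by move=> [e1 f1] [e2 f2] _ _ /= [-> ->].
Qed.

Lemma size_sep_list : (size sep_list <= #|E| * #|E|)%N.
Proof.
rewrite -(size_map fst) cardE -(size_allpairs pair); apply: uniq_leq_size.
  exact: uniq_unzip1_sep_list.
by move=> [e f] _; apply/allpairsP; exists (e, f); rewrite !mem_enum.
Qed.

(** The first element of [E] forms a pair with each other element. Large ground sets thus give
    inputs large enough for the time bound of the arrangement algorithm to apply. *)
Lemma sep_list_size : (#|E| <= (size sep_list).+1)%N.
Proof.
case def_E: (enum E) => [|e0 s]; first by rewrite cardE def_E.
have Eu := enum_uniq E; have sE e : e \in e0 :: s by rewrite -def_E mem_enum.
rewrite def_E in Eu; have /andP [e0s su] := Eu.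
have rank0 : enum_rank e0 = 0%N :> nat.
  have cE : (0 < #|E|)%N by rewrite cardE def_E.
  have : nth e0 (enum E) (enum_rank e0) == nth e0 (enum E) 0 by rewrite nth_enum_rank def_E.
  by rewrite nth_uniq ?enum_uniq -?cardE ?ltn_ord // => /eqP.
rewrite cardE def_E /= ltnS -(size_map fst) -(size_map (pair e0)); apply: uniq_leq_size.
  by rewrite map_inj_uniq // => u v [].
move=> ef /mapP [f fs ->]; apply/mapP; exists ((e0, f), hyp e0 f) => //.
apply/mem_sep_list => /=; split=> //; rewrite rank0 lt0n -rank0.
by apply: contraNneq e0s => /val_inj /enum_rank_inj <-.
Qed.

(** A facet stores a position in the list of hyperplanes; the same position in the list of pairs
    yields the two elements. *)
Lemma onth_sep_list i h : onth (unzip2 sep_list) i = Some h ->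
  exists ef, [/\ onth (unzip1 sep_list) i = Some ef, h = hyp ef.1 ef.2 &
                 (enum_rank ef.1 < enum_rank ef.2)%N].
Proof.
rewrite !onth_map; case def_x: (onth sep_list i) => [[ef h']|] //= [<-].
have /mem_sep_list /= [efr hE] : (ef, h') \in sep_list by apply/onthP; exists i.
by exists ef.
Qed.

Lemma sep_hypsE : [set h | h \in unzip2 sep_list] = @sep_hyps R p E a b.
Proof.
apply/seteqP; split=> h /=.
  by move=> /mapP [[[e f] h'] /mem_sep_list [/= efr ->] ->]; exists e, f.
move=> [e [f [efr ->]]]; apply/mapP; exists ((e, f), hyp e f) => //.
exact/mem_sep_list.
Qed.

Lemma hyp_sep e f : part (hyp e f) Eq = @sep R p E a b e f.
Proof.
apply/seteqP; split=> x => [/side_Eq|xef].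
  by rewrite hval_sep => /eqP; rewrite subr_eq0 => /eqP.
by apply/side_Eq/eqP; rewrite hval_sep subr_eq0; apply/eqP.
Qed.

(** General position determines the unordered pair, and the ranks then fix its order. *)
Lemma part_hyp_inj e f e' f' : general_position R a b ->
  (enum_rank e < enum_rank f)%N -> (enum_rank e' < enum_rank f')%N ->
  part (hyp e f) Eq = part (hyp e' f') Eq -> (e, f) = (e', f').
Proof.
move=> [gp _ _].
have neq (u v : E) : (enum_rank u < enum_rank v)%N -> u != v.
  by apply: contraTneq => ->; rewrite ltnn.
move=> ef ef'; rewrite !hyp_sep => /(gp _ _ _ _ (neq _ _ ef) (neq _ _ ef')) efE.
have : e' \in [set e; f]%SET by rewrite efE finset.in_set2 eqxx.
have : f' \in [set e; f]%SET by rewrite efE finset.in_set2 eqxx orbT.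
rewrite !finset.in_set2 => /orP [] /eqP f'E /orP [] /eqP e'E; rewrite f'E e'E // in ef' *.
- by rewrite ltnn in ef'.
- by have := ltn_trans ef ef'; rewrite ltnn.
- by rewrite ltnn in ef'.
Qed.

Lemma proper_sep_list : (0 < p)%N -> general_position R a b ->
  proper_input (unzip2 sep_list).
Proof.
move=> p0 gp; have inj := fun e f e' f' => @part_hyp_inj e f e' f' gp.
have [_ gp2 gp3] := gp.
split.
- rewrite map_inj_in_uniq; first exact: map_uniq uniq_unzip1_sep_list.
  move=> [[e f] h] [[e' f'] h'] /mem_sep_list [/= ef ->] /mem_sep_list [/= ef' ->] hh'.
  by have [-> ->] := inj _ _ _ _ ef ef' (congr1 (fun h => part h Eq) hh').
- move=> h /mapP [[[e f] h'] /mem_sep_list [/= ef hE] ->].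
  have e_neq_f : e != f by apply: contraTneq ef => ->; rewrite ltnn.
  (* With a zero normal the form is constant, and it vanishes at the point supplied by [has_dim];
     the hyperplane would then contain a vertical line. *)
  apply/eqP; rewrite hE => n0; have [[x [/(_ ord0) x0 _]] _] := gp3 e f e_neq_f.
  have pp : (p.-1 < p)%N by rewrite prednK.
  case: (gp2 e f e_neq_f); exists (Ordinal pp), (x ord0); split; first by rewrite /= prednK.
  move=> t; rewrite -hyp_sep in x0 *; move/side_Eq: x0 => x0; apply/side_Eq.
  by rewrite hvalDZ x0 n0 /slope big1 ?mulr0 ?addr0 // => i _; rewrite mxE mul0r.
- move=> h h' /mapP [[[e f] h1] /mem_sep_list [/= ef ->] ->].
  move=> /mapP [[[e' f'] h2] /mem_sep_list [/= ef' ->] ->] hh'.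
  by have [-> ->] := inj _ _ _ _ ef ef' hh'.
Qed.

End SeparatingHyperplanes.

(** * Passing optimality between faces *)

Section MinBasisTransfer.
Local Open Scope classical_set_scope.
Variables (R : realType) (p : nat) (E : finType) (M : matroid E).
Variables (a : E -> rat) (b : 'I_p -> E -> rat).
Implicit Types (e f g : E) (x y z : 'rV[R]_p) (B : {set E}).

Local Notation w := (weight a b).
Local Notation hyp := (sep_hyp R a b).
Local Notation H := (unzip2 (@sep_list R p E a b)).
Local Notation sg h x := (Num.sg (hval h x)).

Lemma hyp_mem e f : (enum_rank e < enum_rank f)%N -> hyp e f \in H.
Proof.
by move=> ef; apply/mapP; exists ((e, f), hyp e f) => //; apply/mem_sep_list.
Qed.

Lemma sg_sep_lt0 e f x : (sg (hyp e f) x == -1) = (w e x < w f x).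
Proof. by rewrite sgr_cp0 hval_sep subr_lt0. Qed.

Lemma sg_sep_gt0 e f x : (sg (hyp e f) x == 1) = (w f x < w e x).
Proof. by rewrite sgr_cp0 hval_sep subr_gt0. Qed.

Lemma hyp_of_pair g k : g != k ->
  exists2 h, h \in H & h = hyp g k \/ h = hyp k g.
Proof.
move=> gk; case: (ltngtP (enum_rank g) (enum_rank k)) => [lt|lt|/val_inj /enum_rank_inj eq].
- by exists (hyp g k); [apply: hyp_mem | left].
- by exists (hyp k g); [apply: hyp_mem | right].
- by rewrite eq eqxx in gk.
Qed.

Lemma hyp_tie g k h z : h = hyp g k \/ h = hyp k g -> (hval h z == 0) = (w g z == w k z).
Proof. by case=> ->; rewrite hval_sep subr_eq0 // eq_sym. Qed.

Lemma weight_lt_transfer x z g k :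
  (forall h, h \in H -> h = hyp g k \/ h = hyp k g -> sg h x = sg h z) ->
  w g z < w k z -> w g x < w k x.
Proof.
move=> Hxz gkz; have gk : g != k by apply: contraTneq gkz => ->; rewrite ltxx.
have [h hH hE] := hyp_of_pair gk; have := Hxz h hH hE.
case: hE => ->; first by rewrite -(sg_sep_lt0 g k x) => ->; rewrite sg_sep_lt0.
by rewrite -(sg_sep_gt0 k g x) => ->; rewrite sg_sep_gt0.
Qed.

(** The hypothesis holds when [z] lies in the closure of the face of [x]. A strict inequality at [z]
    puts [z] off the hyperplane of the pair, where [x] has the same sign. *)
Lemma weight_lt_open x z : (forall h, h \in H -> hval h z != 0 -> sg h x = sg h z) ->
  forall g k, w g z < w k z -> w g x < w k x.
Proof.
move=> Hxz g k gkz; apply: weight_lt_transfer (gkz) => h hH hE; apply: Hxz => //.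
by rewrite (hyp_tie _ hE) lt_eqF.
Qed.

Lemma weight_le_closed x z : (forall h, h \in H -> hval h z != 0 -> sg h x = sg h z) ->
  forall g k, w g x <= w k x -> w g z <= w k z.
Proof.
by move=> Hxz g k; apply: contraTT; rewrite -!ltNge; apply: weight_lt_open.
Qed.

(** Optimality amounts to weak inequalities between exchanged elements, and these are passed on to
    [z]. *)
Lemma min_basis_degenerate B x z : (forall g k, w g x <= w k x -> w g z <= w k z) ->
  min_basis M a b B x -> min_basis M a b B z.
Proof.
move=> xz [Bb Bx]; split=> // B'; apply: (local_min_basis (w := w^~ z)) => // g h gB hB hi.
by apply: xz; apply: (min_basis_local (w := w^~ x) Bb).
Qed.

(** Writing the weight of a set as an affine form makes [closure_hval_ge0] applicable to the
    difference of two such weights. *)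
Definition set_form B : hyperplane R p :=
  (\row_i \sum_(e in B) ratr (b i e), \sum_(e in B) ratr (a e)).

Lemma hval_set_form B x : hval (set_form B) x = weight_set a b B x.
Proof.
rewrite /hval /weight_set /weight big_split /= addrC; congr (_ + _).
rewrite exchange_big /=; apply: eq_bigr => i _; rewrite mxE mulr_suml.
by apply: eq_bigr => e _; rewrite mulrC.
Qed.

Lemma min_basis_closure B (S : set 'rV[R]_p) x :
  (forall y, S y -> min_basis M a b B y) -> closure S x -> min_basis M a b B x.
Proof.
move=> SB Sx; split.
  by have [y [Sy _]] := Sx setT filterT; case: (SB y Sy).
move=> B' B'b; rewrite -subr_ge0.
pose h : hyperplane R p := ((set_form B').1 - (set_form B).1, (set_form B').2 - (set_form B).2).
have hE y : hval h y = weight_set a b B' y - weight_set a b B y.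
  rewrite -!hval_set_form /hval /= opprD addrACA -sumrB; congr (_ + _).
  by apply: eq_bigr => i _; rewrite !mxE mulrBl.
rewrite -hE; apply: closure_hval_ge0 Sx _ => y /SB [_ /(_ B' B'b)].
by rewrite hE subr_ge0.
Qed.

(** In use, [x] and [y] lie in the two cells of a facet and [z] on the facet. [B] is optimal at [z],
    and so is the exchanged set when it is a basis, as [e] and [f] tie there. *)
Lemma min_basis_cross x y z e f B :
  w e x < w f x -> w f y < w e y -> 
  (forall g k, g != k -> w g z = w k z -> (g = e /\ k = f) \/ (g = f /\ k = e)) ->
  (forall g k, w g x <= w k x -> w g z <= w k z) ->
  (forall g k, w g z < w k z -> w g y < w k y) ->
  w e z = w f z -> min_basis M a b B x ->
  min_basis M a b (if [&& e \in B, f \notin B & (f |: (B :\ e))%SET \in indep M]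
                   then (f |: (B :\ e))%SET else B) y.
Proof.
move=> efx fey tie xz zy efz /(min_basis_degenerate xz) [Bb Bz].
(* A basis optimal at [z] is optimal at [y] unless [e] can be exchanged for [f], since no other tie
   at [z] can turn into a gain. After that exchange [e] is gone, so the criterion applies to the new
   basis. *)
have key B1 : matroid_basis M B1 ->
    (forall B', matroid_basis M B' -> weight_set a b B1 z <= weight_set a b B' z) ->
    ~~ [&& e \in B1, f \notin B1 & (f |: (B1 :\ e))%SET \in indep M] ->
    min_basis M a b B1 y.
  move=> B1b B1z nswap; split=> // B'; apply: (local_min_basis (w := w^~ y)) => // g k gB kB ki.
  have gk : g != k by apply: contraNneq kB => <-.
  have := min_basis_local (w := w^~ z) B1b B1z gB kB ki.
  rewrite le_eqVlt => /orP [/eqP /(tie g k gk) [] [gE kE]|/zy/ltW //].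
    by move: nswap; rewrite -gE -kE gB kB ki.
  by rewrite gE kE ltW.
case: ifP => [/and3P [eB fB Bi]|/negbT]; last exact: key.
have B'b := swap_basis Bb eB fB Bi.
apply: key => // [B'' B''b|].
  apply: le_trans (Bz _ B''b); rewrite /weight_set (sum_swap (w^~ z) eB fB).
  by rewrite efz subrK.
have ef : e != f by apply: contraTneq efx => ->; rewrite ltxx.
by rewrite !inE eqxx (negPf ef) /= .
Qed.

End MinBasisTransfer.

(** * Running times and results of the phases *)

Section Timed.

Lemma result_bind T U (c : timed T) (k : T -> timed U) :
  result (bind c k) = result (k (result c)).
Proof. by []. Qed.

Lemma time_bind T U (c : timed T) (k : T -> timed U) :
  time (bind c k) = (time c + time (k (result c)))%N.
Proof. by []. Qed.

Lemma result_spend T n (x : T) : result (spend n x) = x.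
Proof. by []. Qed.

Lemma time_spend T n (x : T) : time (spend n x) = n.
Proof. by []. Qed.

Lemma for_each_cons T S x (s : seq T) (body : T -> S -> timed S) st :
  for_each (x :: s) body st =
  bind (spend 1 st) (fun st1 => bind (body x st1) (fun st2 => for_each s body st2)).
Proof. by []. Qed.

Definition timedE := (result_bind, time_bind, result_spend, time_spend).

Lemma result_for_each T S (s : seq T) (body : T -> S -> timed S) st :
  result (for_each s body st) = foldl (fun st x => result (body x st)) st s.
Proof. by elim: s st => // x s IH st; rewrite for_each_cons !timedE IH. Qed.

(** Amortized bound with potential [Phi]: the iteration on [x] pays [c x] plus the potential it
    releases. The successor is the step charged per iteration, the final 1 the exit of the loop. *)
Lemma time_for_each (T : eqType) S (Phi : S -> nat) (c : T -> nat) (s : seq T)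
    (body : T -> S -> timed S) st :
  (forall x st, x \in s ->
     (time (body x st) + Phi (result (body x st)) <= c x + Phi st)%N) ->
  (time (for_each s body st) + Phi (result (for_each s body st)) <=
     \sum_(x <- s) (c x).+1 + 1 + Phi st)%N.
Proof.
elim: s st => [|x s IH] st Hs; first by rewrite big_nil.
rewrite for_each_cons !timedE big_cons; have := Hs x st (mem_head x s).
have := IH (result (body x st)) (fun y st ys => Hs y st (mem_behead (s := x :: s) ys)).
lia.
Qed.

Lemma time_for_each_le (T : eqType) S (c : nat) (s : seq T)
    (body : T -> S -> timed S) st :
  (forall x st, x \in s -> (time (body x st) <= c)%N) ->
  (time (for_each s body st) <= size s * c.+1 + 1)%N.
Proof.
move=> Hs; have := @time_for_each _ _ (fun=> 0%N) (fun=> c) s body st.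
rewrite !addn0 big_const_seq count_predT iter_addn_0 mulnC; apply => x st' xs.
by rewrite !addn0 Hs.
Qed.

Lemma foldl_le (T : eqType) S (Phi : S -> nat) (c : T -> nat) (s : seq T)
    (f : S -> T -> S) st :
  (forall x st, x \in s -> (Phi (f st x) <= c x + Phi st)%N) ->
  (Phi (foldl f st s) <= \sum_(x <- s) c x + Phi st)%N.
Proof.
elim: s st => [|x s IH] st Hs /=; first by rewrite big_nil.
rewrite big_cons; have := Hs x st (mem_head x s).
have := IH (f st x) (fun y st ys => Hs y st (mem_behead (s := x :: s) ys)).
lia.
Qed.

Lemma foldl_le_const (T : eqType) S (Phi : S -> nat) (c : nat) (s : seq T)
    (f : S -> T -> S) st :
  (forall x st, x \in s -> (Phi (f st x) <= c + Phi st)%N) ->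
  (Phi (foldl f st s) <= size s * c + Phi st)%N.
Proof.
move=> Hs; have := @foldl_le _ _ Phi (fun=> c) s f st Hs.
by rewrite big_const_seq count_predT iter_addn_0 mulnC.
Qed.

Lemma foldl_iff (T : eqType) S (Q : S -> Prop) (P : T -> Prop) (s : seq T)
    (f : S -> T -> S) st :
  (forall x st, x \in s -> Q (f st x) <-> Q st \/ P x) ->
  Q (foldl f st s) <-> Q st \/ (exists2 x, x \in s & P x).
Proof.
elim: s st => [|x s IH] st Hs /=; first by split; [left | case=> // -[]].
rewrite IH => [|y st' ys]; last by apply: Hs; rewrite in_cons ys orbT.
rewrite Hs ?mem_head //; split.
  case=> [[|Px]|[y ys Py]]; [by left|by right; exists x; rewrite ?mem_head|].
  by right; exists y; rewrite // in_cons ys orbT.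
case=> [|[y]]; first by left; left.
by rewrite in_cons => /orP [/eqP ->|ys Py]; [left; right|right; exists y].
Qed.

Lemma foldl_cons_if T U (P : pred T) (f : T -> U) (s : seq T) acc :
  foldl (fun acc x => if P x then f x :: acc else acc) acc s =
  rev [seq f x | x <- s & P x] ++ acc.
Proof.
elim: s acc => //= x s IH acc; rewrite IH; case: (P x) => //=.
by rewrite rev_cons cat_rcons.
Qed.

Lemma foldl_rev_cat T U (f : T -> seq U) (s : seq T) acc :
  foldl (fun acc x => rev (f x) ++ acc) acc s = rev (flatten (map f s)) ++ acc.
Proof.
by elim: s acc => //= x s IH acc; rewrite IH rev_cat catA.
Qed.

End Timed.

(** * Hyperplanes, cells and the incidence graph *)

Section Preprocessing.
Variables (R : realType) (p : nat) (E : finType).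
Variables (a : E -> rat) (b : 'I_p -> E -> rat).

Lemma result_compute_sep : result (compute_sep R a b) = sep_list R a b.
Proof.
rewrite /compute_sep result_for_each.
rewrite (_ : (fun _ _ => _) = fun acc e => rev [seq ((e, f), sep_hyp R a b e f) |
  f <- [seq f <- enum E | (enum_rank e < enum_rank f)%N]] ++ acc).
  by rewrite foldl_rev_cat cats0.
apply/funext => acc; apply/funext => e; rewrite result_for_each -foldl_cons_if.
congr foldl; apply/funext => acc'; apply/funext => f; rewrite !timedE.
by case: ifP; rewrite !timedE.
Qed.

Lemma time_compute_sep :
  (time (compute_sep R a b) <= #|E| * (#|E| * (p + 4) + 2) + 1)%N.
Proof.
apply: (@leq_trans (size (enum E) * (size (enum E) * (p + 4) + 2) + 1)%N); last by rewrite -cardE.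
(* Comparison, hyperplane and list entry take 1, [p.+1] and 1 steps, and the iteration itself one
   more. *)
have -> : (size (enum E) * (p + 4) + 2 = (size (enum E) * (p + 3).+1 + 1).+1)%N by lia.
apply: time_for_each_le => e acc _; apply: time_for_each_le => f acc' _.
by rewrite !timedE; case: ifP; rewrite !timedE; lia.
Qed.

Lemma mem_list_cells (A : arrangement R p) k :
  (k \in result (list_cells A)) = (fdim A k == p).
Proof.
rewrite /list_cells result_for_each.
rewrite (_ : (fun _ _ => _) = fun acc k => if fdim A k == p then k :: acc else acc).
  by rewrite (foldl_cons_if _ id) cats0 mem_rev map_id mem_filter mem_enum andbT.
by apply/funext => acc; apply/funext => l; rewrite !timedE; case: ifP.
Qed.

Lemma uniq_list_cells (A : arrangement R p) : uniq (result (list_cells A)).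
Proof.
rewrite /list_cells result_for_each.
rewrite (_ : (fun _ _ => _) = fun acc k => if fdim A k == p then k :: acc else acc).
  by rewrite (foldl_cons_if _ id) cats0 rev_uniq map_id filter_uniq // enum_uniq.
by apply/funext => acc; apply/funext => l; rewrite !timedE; case: ifP.
Qed.

Lemma time_list_cells (A : arrangement R p) :
  (time (list_cells A) <= nfaces A * 3 + 1)%N.
Proof.
rewrite -[X in (_ <= X * _ + _)%N]card_ord cardE; apply: time_for_each_le => k acc _.
by rewrite !timedE; case: ifP.
Qed.

Variables (A : arrangement R p) (pairs : seq (E * E)).
Implicit Types (g c : 'I_(nfaces A)).
Hypothesis fups_le2 : forall g, fdim A g = p.-1 -> (size (fups A g) <= 2)%N.

Definition adjacency_size n (adj : adjacency E n) : nat := \sum_k size (adj k).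

Lemma mem_incidence_graph c1 c2 (ef : E * E) :
  (c2, ef) \in result (incidence_graph A pairs) c1 <->
  exists g, [/\ fdim A g = p.-1, obind (onth pairs) (fhyp A g) = Some ef,
                c1 \in fups A g, c2 \in fups A g & c1 != c2].
Proof.
rewrite /incidence_graph !timedE result_for_each.
rewrite (foldl_iff (Q := fun adj : adjacency E _ => (c2, ef) \in adj c1)
  (P := fun g => [/\ fdim A g = p.-1, obind (onth pairs) (fhyp A g) = Some ef,
                c1 \in fups A g, c2 \in fups A g & c1 != c2])) => [|g adj1 _].
  rewrite ffunE; split; first by case=> // -[g _ ?]; exists g.
  by move=> [g ?]; right; exists g; rewrite ?mem_enum.
rewrite ?timedE; case: eqVneq => /= [gd|gd]; last first.
  by rewrite ?timedE; split=> [|[//|[gd' _ _ _ _]]]; [left | rewrite gd' eqxx in gd].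
case def_ef: (obind _ _) => [ef'|] /=; last first.
  by rewrite ?timedE; split=> [|[//|[_ //]]]; left.
rewrite result_for_each.
rewrite (foldl_iff (Q := fun adj : adjacency E _ => (c2, ef) \in adj c1)
  (P := fun c => [/\ ef' = ef, c = c1, c2 \in fups A g & c1 != c2])) => [|c adj2 _].
  split=> [[|[c cg [-> cc1 c2g c12]]]|[|[_ [->] c1g c2g c12]]]; [by left| |by left|].
    by right; rewrite -cc1; split=> //; rewrite cc1.
  by right; exists c1.
rewrite result_for_each.
rewrite (foldl_iff (Q := fun adj : adjacency E _ => (c2, ef) \in adj c1)
  (P := fun c' => [/\ ef' = ef, c = c1, c' = c2 & c1 != c2])) => [|c' adj3 _].
  split=> [[|[c' cg [-> -> c'c2 c12]]]|[|[-> -> c2g c12]]]; [by left| |by left|].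
    by right; rewrite -c'c2; split=> //; rewrite c'c2.
  by right; exists c2.
rewrite ?timedE; case: eqVneq => [->|cc'] /=; rewrite ?timedE.
  split; [by left | case=> // -[_ -> ->]; by rewrite eqxx].
rewrite ffunE; case: eqVneq => [cc1|nc].
  rewrite cc1 inE; split.
    case/orP => [/eqP [-> ->]|]; last by left.
    by right; split=> //; rewrite -cc1.
  by case=> [->|[-> _ -> _]]; rewrite ?orbT // eqxx.
by split; [left | case=> // -[_ /esym/eqP]; rewrite (negPf nc)].
Qed.

Lemma time_incidence_graph :
  (time (incidence_graph A pairs) <= 22 * nfaces A + 1)%N.
Proof.
rewrite /incidence_graph !timedE.
(* An inner iteration spends at most 2 steps in its body; with at most two cells around a facet, the
   inner loop takes at most 7 steps and the middle one 17. A facet thus takes 20, plus one for its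
   iteration, and the table adds one per face. *)
have -> : (22 * nfaces A + 1 = nfaces A + (size (enum 'I_(nfaces A)) * 21 + 1))%N.
  by rewrite -cardE card_ord; lia.
rewrite leq_add2l; apply: time_for_each_le => g adj1 _.
rewrite ?timedE; case: eqVneq => /= [gd|gd]; last by rewrite ?timedE.
case: (obind _ _) => [ef|]; last by rewrite ?timedE.
have fg := fups_le2 gd.
suff : (forall adj, time (for_each (fups A g) (fun c1 adj2 =>
        for_each (fups A g) (fun c2 adj3 =>
          let* new := spend 1 (c1 != c2) in
          if new then update adj3 c1 ((c2, ef) :: adj3 c1)
          else spend 0 adj3) adj2) adj) <= 2 * 8 + 1)%N.
  by move/(_ adj1); lia.
move=> adj.
apply: (@leq_trans (size (fups A g) * 8 + 1)); last by lia.
apply: time_for_each_le => c1 adj2 _.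
apply: (@leq_trans (size (fups A g) * 3 + 1)); last by lia.
apply: time_for_each_le => c2 adj3 _.
by rewrite ?timedE; case: ifP.
Qed.

(** A facet adds at most one entry for each of the four ordered pairs of its at most two cells. *)
Lemma size_incidence_graph :
  (adjacency_size (result (incidence_graph A pairs)) <= 4 * nfaces A)%N.
Proof.
rewrite /incidence_graph !timedE result_for_each.
have -> : (4 * nfaces A = size (enum 'I_(nfaces A)) * 4 +
    @adjacency_size (nfaces A) [ffun => [::]])%N.
  by rewrite -cardE card_ord mulnC /adjacency_size big1 ?addn0 // => k _; rewrite ffunE.
apply: foldl_le_const => g adj1 _.
rewrite ?timedE; case: eqVneq => /= [gd|gd]; last by rewrite ?timedE leq_addl.
case: (obind _ _) => [ef|]; last by rewrite ?timedE leq_addl.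
have fg := fups_le2 gd; rewrite result_for_each.
apply: (@leq_trans (size (fups A g) * 2 + adjacency_size adj1)); last by lia.
apply: foldl_le_const => c1 adj2 _; rewrite result_for_each.
apply: (@leq_trans (size (fups A g) * 1 + adjacency_size adj2)); last by lia.
apply: foldl_le_const => c2 adj3 _; rewrite ?timedE.
case: ifP => _; rewrite ?timedE ?leq_addl // /adjacency_size.
rewrite (bigD1 c1) //= [X in (_ <= 1 + X)%N](bigD1 c1) //= ffunE eqxx /= addnA.
by rewrite add1n leq_add2l; apply: leq_sum => k kc; rewrite ffunE (negPf kc).
Qed.

End Preprocessing.

(** * The greedy algorithm and the crossing step *)

Section Greedy.
Variables (R : realType) (p : nat) (E : finType) (M : matroid E).
Variables (a : E -> rat) (b : 'I_p -> E -> rat) (ftest : nat -> nat).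

Lemma insert_cons (x y : E * R) s : insert x (y :: s) =
  bind (spend 1 (x.2 <= y.2)) (fun le => if le then spend 1 (x :: y :: s)
    else bind (insert x s) (fun r => spend 1 (y :: r))).
Proof. by []. Qed.

Lemma perm_insert (x : E * R) s : perm_eq (result (insert x s)) (x :: s).
Proof.
elim: s => // y s IH; rewrite insert_cons timedE result_spend; case: ifP => _ //.
rewrite !timedE -[x :: y :: s]/([:: x] ++ y :: s) perm_sym.
by rewrite (perm_catCA [:: x] [:: y] s) perm_cons perm_sym.
Qed.

Lemma sorted_insert (x : E * R) s : sorted (relpre snd <=%R) s ->
  sorted (relpre snd <=%R) (result (insert x s)).
Proof.
have path_insert y t : y.2 <= x.2 -> path (relpre snd <=%R) y t ->
    path (relpre snd <=%R) y (result (insert x t)).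
  elim: t y => [|z t IH] y yx; first by rewrite /= yx.
  rewrite insert_cons timedE result_spend /= => /andP [yz zt].
  case: (leP x.2 z.2) => [xz|zx]; rewrite ?timedE /= ?yx ?xz ?yz //.
  by apply: IH => //; apply: ltW.
case: s => // y s ys; rewrite insert_cons timedE result_spend.
case: leP => [xy|yx]; rewrite ?timedE /= ?xy //.
by apply: path_insert => //; apply: ltW.
Qed.

Lemma time_insert (x : E * R) s : (time (insert x s) <= 2 * size s + 1)%N.
Proof.
elim: s => // y s IH; rewrite insert_cons timedE result_spend time_spend.
by case: ifP => _; rewrite ?timedE /=; lia.
Qed.

Variable x : 'rV[R]_p.
Local Notation sorted_list := (result (sort_by_weight a b x)).

Lemma result_sort_by_weight : sorted_list =
  foldl (fun acc e => result (insert (e, weight a b e x) acc)) [::] (enum E).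
Proof. by rewrite /sort_by_weight result_for_each. Qed.

Lemma perm_sort_by_weight :
  perm_eq sorted_list [seq (e, weight a b e x) | e <- enum E].
Proof.
rewrite result_sort_by_weight -[X in perm_eq _ X]cats0.
elim: (enum E) [::] => //= e s IH acc.
apply: (perm_trans (IH _)); rewrite -cat_cons -cat1s -catA perm_sym perm_catCA.
by rewrite perm_cat2l perm_sym; apply: perm_insert.
Qed.

Lemma sorted_sort_by_weight : sorted (relpre snd <=%R) sorted_list.
Proof.
rewrite result_sort_by_weight; have : sorted (relpre snd <=%R) ([::] : seq (E * R)) by [].
elim: (enum E) [::] => //= e s IH acc accs.
by apply: IH; apply: sorted_insert.
Qed.

Lemma time_sort_by_weight :
  (time (sort_by_weight a b x) <= #|E| * (2 * p + 2 * #|E| + 2) + 1)%N.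
Proof.
rewrite /sort_by_weight; set body := fun e acc => _.
(* Insertion is linear in the accumulator; the sum of the two sizes stays constant along the
   recursion. *)
have Hs s acc : (time (for_each s body acc) <=
    size s * (2 * p + 2 * (size s + size acc) + 2) + 1)%N.
  elim: s acc => // e s IH acc; rewrite for_each_cons !timedE.
  have := IH (result (body e acc)); have := time_insert (e, weight a b e x) acc.
  rewrite /body !timedE (perm_size (perm_insert _ _)) /=; nia.
by have := Hs (enum E) [::]; rewrite -cardE addn0.
Qed.

Lemma result_greedy : result (greedy M a b ftest x) = greedy_set M (unzip1 sorted_list).
Proof.
rewrite /greedy !timedE result_for_each /greedy_set /unzip1.
elim: sorted_list finset.set0 => //= ew s IH B; rewrite IH !timedE.
Qed.

Lemma greedy_min : min_basis M a b (result (greedy M a b ftest x)) x.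
Proof.
rewrite result_greedy; apply: (@greedy_min_basis E M R (fun e => weight a b e x)).
  move=> e; rewrite (perm_mem (perm_map fst perm_sort_by_weight)) -map_comp map_id_in //.
  by rewrite mem_enum.
have sE u : u \in sorted_list -> u.2 = weight a b u.1 x.
  by rewrite (perm_mem perm_sort_by_weight) => /mapP [e _ ->].
rewrite sorted_map; have := sorted_sort_by_weight.
apply: (@sub_in_sorted _ (mem sorted_list)); last by apply/allP.
by move=> u v us vs; rewrite /= (sE u us) (sE v vs).
Qed.

Lemma time_greedy : (time (greedy M a b ftest x) <=
  #|E| * (2 * p + 2 * #|E| + 2) + 1 + (#|E| * (ftest #|E| + 2) + 1))%N.
Proof.
rewrite /greedy !timedE leq_add ?time_sort_by_weight //.
have szE : size sorted_list = #|E|.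
  by rewrite (perm_size perm_sort_by_weight) size_map -cardE.
have -> : (#|E| * (ftest #|E| + 2) + 1 = size sorted_list * (ftest #|E| + 1).+1 + 1)%N.
  by rewrite szE -[(_ + 1).+1]addn1 -[(_ + 1 + 1)%N]addnA.
apply: (@time_for_each_le (E * R)%type _ (ftest #|E| + 1)) => ew B _.
by rewrite !timedE.
Qed.

Lemma result_cross (y : 'rV[R]_p) ef B : result (cross M a b ftest y ef B) =
  let lt := weight a b ef.1 y < weight a b ef.2 y in
  let e := if lt then ef.1 else ef.2 in let f := if lt then ef.2 else ef.1 in
  if [&& e \in B, f \notin B & (f |: (B :\ e))%SET \in indep M]
  then (f |: (B :\ e))%SET else B.
Proof. by []. Qed.

End Greedy.

(** * Breadth-first search *)

Section BreadthFirstSearch.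
Variables (R : realType) (p : nat) (E : finType) (M : matroid E).
Variables (a : E -> rat) (b : 'I_p -> E -> rat) (ftest : nat -> nat).
Variables (A : arrangement R p) (adj : adjacency E (nfaces A)).
Local Notation n := (nfaces A).
Local Notation state := (bfs_state E n).
Implicit Types (st : state) (k c : 'I_n) (B : {set E}) (edge : 'I_n * (E * E)).

Local Notation visit c B := (@visit R p E M a b ftest A c B).
Local Notation crossed c edge B := (result (cross M a b ftest (fpt A c) edge.2 B)).
Local Notation loop := (@bfs_loop R p E M a b ftest A adj).

Definition visited st k := isSome (st.2 k).

Definition enqueue st edge B : state :=
  (rcons st.1 (edge.1, B), [ffun j => if j == edge.1 then Some B else st.2 j]).

Lemma result_visit c B edge st : result (visit c B edge st) =
  if visited st edge.1 then st else enqueue st edge (crossed c edge B).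
Proof. by rewrite /Defs.visit !timedE /visited; case: ifP; rewrite ?timedE. Qed.

Lemma time_visit c B edge st : time (visit c B edge st) =
  if visited st edge.1 then 1%N else (4 * p + ftest #|E| + 7)%N.
Proof.
rewrite /Defs.visit !timedE /visited; case: ifP => _; rewrite ?timedE //.
by lia.
Qed.

Lemma result_loopS fuel c B q t : result (loop fuel.+1 ((c, B) :: q, t)) =
  result (loop fuel (foldl (fun st edge => result (visit c B edge st)) (q, t) (adj c))).
Proof. by rewrite -(result_for_each (adj c) (visit c B)). Qed.

Lemma time_loopS fuel c B q t : time (loop fuel.+1 ((c, B) :: q, t)) =
  (1 + (time (for_each (adj c) (visit c B) (q, t)) +
     time (loop fuel (result (for_each (adj c) (visit c B) (q, t))))))%N.
Proof. by []. Qed.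

(* Amortization: a node in the queue carries the cost w of expanding it, and an
   unvisited node moreover the cost K of computing its basis. *)
Definition credit (w : 'I_n -> nat) K st : nat :=
  \sum_(kB <- st.1) w kB.1 + \sum_(k | ~~ visited st k) (w k + K).

(** The node moves from the unvisited ones into the queue: its [w] stays counted, and its [K] is
    released to pay for its basis. *)
Lemma credit_enqueue w K st edge B : ~~ visited st edge.1 ->
  (credit w K (enqueue st edge B) + K = credit w K st)%N.
Proof.
move=> nv; rewrite /credit /enqueue /= big_rcons /=.
rewrite [X in _ = (_ + X)%N](bigD1 edge.1) //=.
rewrite [X in (_ + X + _)%N](eq_bigl (fun k => ~~ visited st k && (k != edge.1))).
  by rewrite -!addnA; congr (_ + (_ + _))%N; rewrite addnC.
by move=> k; rewrite /visited ffunE /=; case: (k == edge.1); rewrite ?andbF ?andbT.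
Qed.

Lemma time_bfs_loop fuel st :
  (time (loop fuel st) <=
     credit (fun k => 2 * size (adj k) + 2) (4 * p + ftest #|E| + 6) st + 1)%N.
Proof.
(* Expanding a node takes two steps per edge, for iteration and lookup, one for dequeuing and one
   for leaving the loop. The other [K] steps of a visit occur only when a node is reached for the
   first time. *)
set w := fun k => _; set K := (4 * p + _ + 6)%N.
elim: fuel st => [|fuel IH] [[|[c B] q] t]; try exact: leq_addl.
rewrite time_loopS.
have step edge st : edge \in adj c ->
    (time (visit c B edge st) + credit w K (result (visit c B edge st)) <= 1 + credit w K st)%N.
  move=> _; rewrite time_visit result_visit; case: ifP => [//|/negbT nv].
  have <- := credit_enqueue w K (crossed c edge B) nv.
  by move: (credit w K _) => u; rewrite /K; lia.
have := @time_for_each _ _ (credit w K) (fun=> 1%N) _ _ (q, t) step.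
rewrite big_const_seq count_predT iter_addn_0.
have := IH (result (for_each (adj c) (visit c B) (q, t))).
have -> : credit w K ((c, B) :: q, t) = (w c + credit w K (q, t))%N.
  by rewrite /credit big_cons addnA.
have -> : w c = (2 * size (adj c) + 2)%N by [].
move: (time _) (time _) (credit w K _) (credit w K _) (size (adj c)) => ? ? ? ? ?; lia.
Qed.

(** Queue length plus number of unvisited nodes, a bound on the iterations still to come: a visit
    preserves it, and dequeuing lowers it by one. *)
Definition pending st : nat := credit (fun=> 1%N) 0 st.

Variable good : 'I_n -> {set E} -> Prop.
Hypothesis good_cross : forall c B edge, good c B -> edge \in adj c ->
  good edge.1 (crossed c edge B).

Definition sound st := (forall k B, st.2 k = Some B -> good k B) /\
  (forall kB, kB \in st.1 -> st.2 kB.1 = Some kB.2).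

Definition expanded st k := forall edge, edge \in adj k -> visited st edge.1.

Lemma visited_enqueue st edge B k :
  visited (enqueue st edge B) k = (k == edge.1) || visited st k.
Proof. by rewrite /visited ffunE; case: eqP. Qed.

(** The invariant while [c] is being expanded. [c] is exempt from it, having left the queue while
    some of its edges are still to be followed. *)
Lemma visits_correct c B st (s : seq ('I_n * (E * E))) :
  good c B -> {subset s <= adj c} -> sound st ->
  (forall k, visited st k -> k = c \/ k \in unzip1 st.1 \/ expanded st k) ->
  let st' := foldl (fun st edge => result (visit c B edge st)) st s in
  [/\ sound st',
      forall k, visited st k -> visited st' k,
      forall edge, edge \in s -> visited st' edge.1,
      forall k, visited st' k -> k = c \/ k \in unzip1 st'.1 \/ expanded st' k &
      pending st' = pending st].
Proof.
move=> gcB; elim: s st => [|edge s IH] st sadj sst inv; first by split.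
have [eadj {}sadj] : edge \in adj c /\ {subset s <= adj c}.
  by split=> [|e es]; apply: sadj; rewrite inE ?eqxx // es orbT.
rewrite [foldl _ _ _](_ : _ =
  foldl (fun st edge => result (visit c B edge st)) (result (visit c B edge st)) s) //.
rewrite [result (visit c B edge st)]result_visit; case: ifP => [ve|/negbT nve].
  have [? mono vs ? ?] := IH st sadj sst inv; split=> // e.
  by rewrite inE => /orP [/eqP ->|/vs //]; apply: mono.
set st1 := enqueue _ _ _.
have gB : good edge.1 (crossed c edge B) := good_cross gcB eadj.
have sst1 : sound st1.
  case: sst => st_good st_q; split=> [k B'|kB].
    by rewrite ffunE; case: eqVneq => [-> [<-] //|_]; apply: st_good.
  rewrite mem_rcons inE => /orP [/eqP -> /=|kBq]; first by rewrite ffunE eqxx.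
  rewrite ffunE; case: eqVneq => [kE|_]; last exact: st_q.
  by move: nve; rewrite -kE /visited (st_q _ kBq).
have mono1 k : visited st k -> visited st1 k by rewrite visited_enqueue => ->; rewrite orbT.
have [|? mono vs ? pend] := IH st1 sadj sst1 _.
  move=> k; rewrite visited_enqueue => /orP [/eqP ->|/inv [->|[kq|kex]]].
  - by right; left; rewrite /st1 /= /unzip1 map_rcons mem_rcons mem_head.
  - by left.
  - by right; left; rewrite /st1 /= /unzip1 map_rcons mem_rcons in_cons kq orbT.
  - by right; right=> e /kex; apply: mono1.
split=> // [k /mono1 /mono //|e|].
  rewrite inE => /orP [/eqP ->|/vs //]; apply: mono.
  by rewrite visited_enqueue eqxx.
by rewrite pend -[RHS](credit_enqueue _ _ (crossed c edge B) nve) addn0.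
Qed.

(** With enough fuel for [pending st] the loop stops only on an empty queue, and then every visited
    node has been expanded. *)
Lemma bfs_loop_correct fuel st : (pending st <= fuel)%N -> sound st ->
  (forall k, visited st k -> k \in unzip1 st.1 \/ expanded st k) ->
  let st' := result (loop fuel st) in
  [/\ sound st', forall k, visited st k -> visited st' k &
      forall k, visited st' k -> expanded st' k].
Proof.
elim: fuel st => [|fuel IH] [[|[c B] q] t] pend sst inv.
- by split=> //= k /inv [].
- by move: pend; rewrite /pending /credit big_cons.
- by split=> //= k /inv [].
have gcB : good c B.
  by case: sst => st_good st_q; apply/st_good/(st_q (c, B)); apply: mem_head.
rewrite result_loopS.
have [|||sst' mono vs inv' pend'] := visits_correct (st := (q, t)) gcB (s := adj c).
- by [].
- by case: sst => st_good st_q; split=> // kB kBq; apply: st_q; rewrite in_cons kBq orbT.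
- by move=> k /inv []; [rewrite /= in_cons => /orP [/eqP|]; [left|right; left] | right; right].
have [||sf monof expf] := IH _ _ sst'.
- by rewrite pend' -ltnS; move: pend; rewrite /pending /credit big_cons -addnA.
- by move=> k /inv' [->|//]; right=> edge /vs.
by split=> // k /mono /monof.
Qed.

End BreadthFirstSearch.

(** * The complete algorithm *)

Section Search.
Local Open Scope classical_set_scope.
Variables (R : realType) (p : nat) (E : finType) (M : matroid E).
Variables (a : E -> rat) (b : 'I_p -> E -> rat) (ftest : nat -> nat).
Variable start : forall n, 'I_n -> seq 'I_n -> 'I_n.
Variable A : arrangement R p.
Local Notation n := (nfaces A).
Local Notation w := (weight a b).
Local Notation H := (unzip2 (sep_list R a b)).
Local Notation pairs := (unzip1 (sep_list R a b)).

(** What [bfs_algorithm] does once the arrangement is known, with a variable [A] in place of the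
    result of [arr]. *)
Definition search (prs : seq (E * E)) : timed (answer R p E) :=
  let* cells := list_cells A in
  let* adj := incidence_graph A prs in
  if cells is c :: cs then
    let* c0 := spend 1 (start c cs) in
    let* B0 := greedy M a b ftest (fpt A c0) in
    let* none := new_table (nfaces A) None in
    let* bases0 := update none c0 (Some B0) in
    let* st := bfs_loop M a b ftest adj (nfaces A) ([:: (c0, B0)], bases0) in
    let* out := for_each cells (fun k acc =>
      spend 1 (if st.2 k is Some B then (k, B) :: acc else acc)) [::] in
    spend 1 (@Answer R p E A out)
  else spend 1 (@Answer R p E A [::]).

Hypotheses (p_gt0 : (0 < p)%N) (gp : general_position R a b) (Arep : represents H A).
Hypothesis startP : forall n (c : 'I_n) (cs : seq 'I_n), start c cs \in c :: cs.
Let Hprop : proper_input H := proper_sep_list p_gt0 gp.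

(** Optimality is tracked at the stored point alone; the rest of the cell follows by
    [weight_le_closed], its closure by [min_basis_closure]. *)
Definition optimal (k : 'I_n) (B : {set E}) : Prop :=
  fdim A k = p /\ min_basis M a b B (fpt A k).

Lemma answer_solves (D : set 'rV[R]_p) (out : seq ('I_n * {set E})) :
  uniq (unzip1 out) -> (forall kB, kB \in out -> optimal kB.1 kB.2) ->
  (forall k, fdim A k = p -> k \in unzip1 out) ->
  solves M a b D (@Answer R p E A out).
Proof.
move=> out_uniq out_opt out_all.
have partE i x : @ans_part R p E a b D (Answer out) i x <->
    D x /\ closure (node_face [set h | h \in H] (tnth (in_tuple out) i).1) x.
  by rewrite /ans_part /= sep_hypsE.
split; first split.
- apply/seteqP; split=> [x [i _ /partE []] //|x Dx].
  have [c /out_all /mapP [kB /seq_tnthP [i ->] ->] xc] := cells_cover Hprop Arep x.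
  by exists i => //; apply/partE.
- move=> i j ij; apply/eqP; apply: contraNT ij => /set0P ne0.
  have mem l : tnth (in_tuple out) l \in out by apply: mem_tnth.
  have [[di _] [dj _]] := (out_opt _ (mem i), out_opt _ (mem j)).
  have kk : (tnth (in_tuple out) i).1 = (tnth (in_tuple out) j).1.
    by apply: (cells_overlap Hprop Arep di dj _ ne0) => x [/partE [_ xi] /partE [_ xj]].
  pose kB0 := tnth (in_tuple out) i.
  have nthE (l : 'I_(size out)) : nth kB0.1 (unzip1 out) l = (tnth (in_tuple out) l).1.
    by rewrite (nth_map kB0) // (tnth_nth kB0).
  by rewrite -val_eqE -(nth_uniq kB0.1 _ _ out_uniq) ?size_map ?ltn_ord // !nthE kk.
- move=> i x /partE [_]; have [kd kB] := out_opt _ (mem_tnth i (in_tuple out)).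
  apply: min_basis_closure => y yk; apply: min_basis_degenerate kB.
  by apply: weight_le_closed => h hH _; have /node_faceP -> := yk.
Qed.

(** The invariant of the search: [min_basis_cross] at the stored points of two neighbouring cells
    and of their common facet. *)
Lemma optimal_cross (c : 'I_n) (B : {set E}) (edge : 'I_n * (E * E)) :
  optimal c B -> edge \in result (incidence_graph A pairs) c ->
  optimal edge.1 (result (cross M a b ftest (fpt A c) edge.2 B)).
Proof.
case: edge => c2 ef [cd Bc] /mem_incidence_graph [g [gd gef cg c2g cc2]].
have [i [h [gi hi hH hg gH]]] := facet_hyperplane p_gt0 Hprop Arep gd.
have [ef' [efi hE efr]] := onth_sep_list hi.
have {gef efi}ef'E : ef' = ef by move: gef; rewrite gi /= efi => -[].
rewrite {}ef'E in hE efr.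
have opp := facet_sides p_gt0 Hprop Arep gd cg c2g hH hg cc2.
have /(cell_of_facet p_gt0 Hprop Arep _ gd) [cH cgH] := cg.
have /(cell_of_facet p_gt0 Hprop Arep _ gd) [c2H c2gH] := c2g.
split; first by apply/(cellP Hprop Arep).
rewrite result_cross /=.
(* A tie of [u] and [v] at the stored point of the facet puts that point on h(u, v). It lies on no
   hyperplane but [h], so the pair is [ef] up to order. *)
have tie u v : u != v -> w u (fpt A g) = w v (fpt A g) ->
    (u = ef.1 /\ v = ef.2) \/ (u = ef.2 /\ v = ef.1).
  have wlog_tie u' v' : (enum_rank u' < enum_rank v')%N ->
      w u' (fpt A g) = w v' (fpt A g) -> (u', v') = ef.
    move=> uv uvg; rewrite [ef]surjective_pairing; apply: (part_hyp_inj gp uv efr).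
    have [-> //|/(gH _ (hyp_mem _ a b uv))] := eqVneq (sep_hyp R a b u' v') h; first by rewrite hE.
    by rewrite hval_sep uvg subrr eqxx.
  move=> uv uvg; case: (ltngtP (enum_rank u) (enum_rank v)) => [lt|lt|].
  - by left; rewrite -(wlog_tie _ _ lt uvg).
  - by right; rewrite -(wlog_tie _ _ lt (esym uvg)).
  - by move=> /val_inj /enum_rank_inj uv'; rewrite uv' eqxx in uv.
have le_g := weight_le_closed cgH.
have lt_c2 := weight_lt_open c2gH.
have tie_g : w ef.1 (fpt A g) = w ef.2 (fpt A g).
  by apply/eqP; rewrite -subr_eq0 -hval_sep -hE hg.
have := cH h hH; rewrite hE hval_sep subr_eq0 => neq_c.
(* [cross] orders the pair by the weights at the point of [c], so both orders are prepared. *)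
have lt_opp (e f : E) : (e = ef.1 /\ f = ef.2) \/ (e = ef.2 /\ f = ef.1) ->
    w e (fpt A c) < w f (fpt A c) -> w f (fpt A c2) < w e (fpt A c2).
  move: opp; rewrite hE => opp; case=> [[-> ->]|[-> ->]].
    by rewrite -sg_sep_lt0 opp eqr_opp sg_sep_gt0.
  by rewrite -sg_sep_gt0 opp eqr_oppLR sg_sep_lt0.
case: (ltP (w ef.1 (fpt A c)) (w ef.2 (fpt A c))) => [lt|].
  by apply: (min_basis_cross (x := fpt A c) (z := fpt A g)) => //; apply: lt_opp => //; left.
rewrite le_eqVlt eq_sym (negPf neq_c) /= => lt.
apply: (min_basis_cross (x := fpt A c) (z := fpt A g)) => //.
  by apply: lt_opp => //; right.
by move=> u v uv /(tie u v uv) [|]; [right|left].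
Qed.

Lemma mem_collect (t : {ffun 'I_n -> option {set E}}) cells kB :
  kB \in foldl (fun acc k => if t k is Some B then (k, B) :: acc else acc) [::] cells <->
  kB.1 \in cells /\ t kB.1 = Some kB.2.
Proof.
rewrite (foldl_iff (Q := fun acc => kB \in acc) (P := fun k => kB.1 = k /\ t k = Some kB.2)).
  by split=> [[//|[k kc [-> ->]]]//|[kc tk]]; right; exists kB.1.
move=> k acc _; case def_t: (t k) => [B|]; last by split=> [|[//|[]]]; [left|].
rewrite inE; split=> [/orP [/eqP -> /=|]|[->|[k1 [k2]]]]; rewrite ?orbT //; [by right|by left|].
by rewrite -k1 k2 -surjective_pairing eqxx.
Qed.

Lemma uniq_collect (t : {ffun 'I_n -> option {set E}}) cells : uniq cells ->
  uniq (unzip1 (foldl (fun acc k => if t k is Some B then (k, B) :: acc else acc) [::] cells)).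
Proof.
have Hacc (acc : seq ('I_n * {set E})) : uniq (unzip1 acc) -> uniq cells ->
    (forall k, k \in cells -> k \notin unzip1 acc) ->
    uniq (unzip1 (foldl (fun acc k => if t k is Some B then (k, B) :: acc else acc) acc cells)).
  elim: cells acc => //= k cells IH acc accu /andP [kc cu] kacc.
  have kn := kacc k (mem_head _ _); apply: IH => //.
    by case: (t k) => [B|] //=; rewrite kn.
  move=> l lc; have ln : l \notin unzip1 acc by apply: kacc; rewrite inE lc orbT.
  case: (t k) => [B|] //=; rewrite inE negb_or ln andbT.
  by apply: contraNneq kc => <-.
by move=> cu; apply: Hacc.
Qed.

Lemma search_solves (D : set 'rV[R]_p) : solves M a b D (result (search pairs)).
Proof.
rewrite /search 2!result_bind; set adj := result (incidence_graph A pairs).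
have := uniq_list_cells A; have := @mem_list_cells R p A.
case: (result (list_cells A)) => [|c cs] cellsP cells_uniq.
  (* The list of cells is nonempty: some cell has the origin in its closure. *)
  have [k kd _] := cells_cover Hprop Arep 0.
  by have := cellsP k; rewrite kd eqxx.
pose c0 := start c cs; pose B0 := result (greedy M a b ftest (fpt A c0)).
pose st0 : bfs_state E n :=
  ([:: (c0, B0)], [ffun j => if j == c0 then Some B0 else [ffun=> None] j]).
pose st := result (bfs_loop M a b ftest adj n st0).
change (solves M a b D (Answer (result (for_each (c :: cs) (fun k acc =>
  spend 1 (if st.2 k is Some B then (k, B) :: acc else acc)) [::])))).
rewrite result_for_each.
have c0d : fdim A c0 = p by apply/eqP; rewrite -cellsP; apply: startP.
have c0opt : optimal c0 B0 by split=> //; apply: greedy_min.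
have st0E k : st0.2 k = if k == c0 then Some B0 else None by rewrite !ffunE.
(* One node in the queue and all others unvisited give [n] in total, which is the fuel provided. *)
have pend : (pending st0 <= n)%N.
  rewrite /pending /credit big_seq1 (eq_bigl (fun k => k != c0)).
    have := cardC1 c0; rewrite card_ord => nE; rewrite sum_nat_const addn0 muln1 nE.
    by rewrite add1n prednK // (leq_ltn_trans _ (ltn_ord c0)).
  by move=> k; rewrite /visited st0E; case: eqP.
have snd0 : sound optimal st0.
  split=> [k B|kB]; first by rewrite st0E; case: eqP => // -> [<-].
  by rewrite inE st0E => /eqP -> /=; rewrite eqxx.
have inv0 k : visited st0 k -> k \in unzip1 st0.1 \/ expanded adj st0 k.
  by rewrite /visited st0E; case: eqP => // ->; left; apply: mem_head.
have [[sf _] mono expd] := bfs_loop_correct optimal_cross pend snd0 inv0.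
(* The visited nodes are closed under crossing facets, since each has been expanded; by connectivity
   they include every cell. *)
have all_visited k : fdim A k = p -> visited st k.
  move=> kd; apply: (cells_connected p_gt0 Hprop Arep (V := visited st) c0d kd).
    by apply: mono; rewrite /visited st0E eqxx.
  move=> g c1 c2 gd c1g c2g vc1; have [<- //|c12] := eqVneq c1 c2.
  have [i [h [gi hi _ _ _]]] := facet_hyperplane p_gt0 Hprop Arep gd.
  have [ef [efi _ _]] := onth_sep_list hi.
  apply: (expd c1 vc1 (c2, ef)); apply/mem_incidence_graph; exists g; split=> //.
  by rewrite gi /= efi.
apply: answer_solves; first exact: uniq_collect.
  by move=> kB /mem_collect [_ /sf].
move=> k kd; have := all_visited k kd; rewrite /visited; case def_B: (st.2 k) => [B|//] _.
by apply/mapP; exists (k, B) => //; apply/mem_collect; split=> //=; rewrite cellsP kd eqxx.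
Qed.

Lemma time_search : (time (search pairs) <=
  n * (ftest #|E| + 4 * p + 44) + #|E| * (ftest #|E| + 2 * p + 2 * #|E| + 4) + 20)%N.
Proof.
have fups2 g : fdim A g = p.-1 -> (size (fups A g) <= 2)%N :=
  size_fups p_gt0 Hprop Arep (g := g).
rewrite /search 2!time_bind; set adj := result (incidence_graph A pairs).
have Tc := time_list_cells A.
have Ti : (time (incidence_graph A pairs) <= 22 * n + 1)%N := time_incidence_graph pairs fups2.
have Si : (adjacency_size adj <= 4 * n)%N := size_incidence_graph pairs fups2.
have cu := uniq_list_cells A.
case: (result (list_cells A)) cu => [|c cs] cu; first by rewrite time_spend; nia.
have Tg := time_greedy M a b ftest (fpt A (start c cs)).
pose c0 := start c cs; pose B0 := result (greedy M a b ftest (fpt A c0)).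
pose st0 : bfs_state E n :=
  ([:: (c0, B0)], [ffun j => if j == c0 then Some B0 else [ffun=> None] j]).
pose st := result (bfs_loop M a b ftest adj n st0).
have st0E k : st0.2 k = if k == c0 then Some B0 else None by rewrite !ffunE.
have Tl := time_bfs_loop M a b ftest adj n st0.
set credit0 := credit _ _ _ in Tl.
(* The edges contribute twice the adjacency size, at most 8n; each node adds the constant 2 and at
   most the cost of computing its basis. *)
have {Si}credit_le : (credit0 <= 8 * n + n * (4 * p + ftest #|E| + 8))%N.
  apply: (@leq_trans (\sum_k (2 * size (adj k) + (4 * p + ftest #|E| + 8)))).
    rewrite /credit0 /credit big_seq1 /= [in leqRHS](bigD1 c0) //=.
    apply: leq_add; first by lia.
    rewrite (eq_bigl (fun k => k != c0)).
      by apply: leq_sum => k _; lia.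
    by move=> k; rewrite /visited st0E; case: eqP.
  rewrite big_split /= sum_nat_const card_ord leq_add2r -big_distrr /=.
  by rewrite -[8%N]/(2 * 4)%N -mulnA leq_mul2l.
pose Tout := time (for_each (c :: cs) (fun k acc =>
  spend 1 (if st.2 k is Some B then (k, B) :: acc else acc)) [::]).
change (time (list_cells A) + (time (incidence_graph A pairs) +
  (1 + (time (greedy M a b ftest (fpt A c0)) + (n + (1 +
    (time (bfs_loop M a b ftest adj n st0) + (Tout + 1))))))) <=
  n * (ftest #|E| + 4 * p + 44) + #|E| * (ftest #|E| + 2 * p + 2 * #|E| + 4) + 20)%N.
have {cu}To : (Tout <= n * 2 + 1)%N.
  apply: (@leq_trans (size (c :: cs) * 2 + 1)); first by apply: time_for_each_le.
  rewrite leq_add2r leq_mul2r; apply/orP; right.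
  by rewrite -(card_uniqP cu) (leq_trans (max_card _)) // card_ord.
rewrite -/c0 in Tg.
move: (time (list_cells A)) (time (incidence_graph A pairs))
  (time (greedy M a b ftest (fpt A c0))) (time (bfs_loop M a b ftest adj n st0))
  Tout credit0 Tc Ti Tg Tl credit_le To => t1 t2 t3 t4 t5 t6.
move: n (ftest #|E|) #|E| => k f m; nia.
Qed.

End Search.

Theorem theorem3p6 (R : realType) (p : nat) (hp : (2 <= p)%N)
  (arr : seq (hyperplane R p) -> timed (arrangement R p))
  (harr : arrangement_algorithm arr) :
  exists C N : nat,
  forall (E : finType) (M : matroid E)
    (a : E -> rat) (b : 'I_p -> E -> rat) (I : 'I_p -> interval R)
    (ftest : nat -> nat) (start : forall n : nat, 'I_n -> seq 'I_n -> 'I_n),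
  general_position R a b ->
  (0 < ftest #|E|)%N ->
  (forall (n : nat) (c : 'I_n) (cs : seq 'I_n), start n c cs \in c :: cs) ->
  let run := bfs_algorithm arr M a b ftest start in
  solves M a b (param_box I) (result run) /\
  ((N <= #|E|)%N ->
   (time run <= C * (#|E| ^ (2 * p) * ftest #|E|))%N).
Proof.
have p_gt0 : (0 < p)%N by apply: ltn_trans hp.
have [arrP [C0 [N0 arrT]]] := harr.
(* [C0] pays for the arrangement; [3 ^ p] bounds the number of faces relative to m^(2p), with
   [4 * p + 45] per face; [3 * p] covers hyperplanes and weight evaluations, and 50 the remaining
   constants. [N0.+1] is chosen because m elements give at least m - 1 hyperplanes. *)
exists (C0 + 3 ^ p * (4 * p + 45) + 3 * p + 50)%N, N0.+1.
move=> E M a b I ftest start gp f_gt0 startP run.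
have Hprop := proper_sep_list p_gt0 gp.
set L := sep_list R a b in Hprop *.
have Arep := arrP _ Hprop.
split.
  have -> : result run = result (search M a b ftest start (result (arr (unzip2 L))) (unzip1 L)).
    by rewrite /L -result_compute_sep.
  exact: search_solves.
move=> leNm.
have -> : time run = (time (compute_sep R a b) + (size L + (size L + (time (arr (unzip2 L)) +
    time (search M a b ftest start (result (arr (unzip2 L))) (unzip1 L))))))%N.
  by rewrite /L -result_compute_sep.
set A := result (arr _) in Arep *.
have m_gt0 : (0 < #|E|)%N by apply: leq_trans leNm.
have sz2 : size (unzip2 L) = size L by rewrite size_map.
have := arrT _ Hprop; rewrite sz2 => {}arrT.
have {}arrT : (time (arr (unzip2 L)) <= C0 * size L ^ p)%N.
  by apply: arrT; rewrite -ltnS; apply: leq_trans leNm (sep_list_size _ _ _).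
have szL : (size L <= #|E| ^ 2)%N by rewrite -mulnn size_sep_list.
have nle := nfaces_le Arep; rewrite sz2 in nle.
have Tc := time_compute_sep R a b.
have Ts := time_search M ftest start p_gt0 gp Arep.
(* For q at most m^2 and m positive, 2q + 1 is at most 3m^2. *)
have {}nle : (nfaces A <= 3 ^ p * #|E| ^ (2 * p))%N.
  apply: leq_trans nle _; rewrite expnM -expnMn leq_exp2r //.
  have : (0 < #|E| ^ 2)%N by rewrite expn_gt0 m_gt0.
  lia.
have {}arrT : (time (arr (unzip2 L)) <= C0 * #|E| ^ (2 * p))%N.
  apply: leq_trans arrT _; rewrite expnM leq_mul2l leq_exp2r // szL orbT //.
have mm : (#|E| ^ 2 <= #|E| ^ (2 * p))%N.
  by rewrite leq_pexp2l //; lia.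
move: (time (arr _)) (time (compute_sep _ _ _)) (time (search _ _ _ _ _ _ _)) Tc Ts arrT.
move=> tA tC tS Tc Ts arrT.
move: (size L) szL => q szL.
have fP : (#|E| ^ (2 * p) <= #|E| ^ (2 * p) * ftest #|E|)%N by rewrite leq_pmulr.
(* [X] is m^(2p) f(m); each separate cost is now bounded by a multiple of it. *)
set X := (_ * ftest #|E|)%N in fP *.
have mm2 : (#|E| * #|E| <= X)%N by rewrite mulnn (leq_trans mm).
have m1 : (#|E| <= X)%N by apply: leq_trans mm2; rewrite leq_pmulr.
have mf : (#|E| * ftest #|E| <= X)%N.
  rewrite leq_mul2r; apply/orP; right; apply: leq_trans mm; rewrite -mulnn leq_pmulr //.
have nX : (nfaces A <= 3 ^ p * X)%N by apply: leq_trans nle _; rewrite leq_mul2l fP orbT.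
have nf : (nfaces A * ftest #|E| <= 3 ^ p * X)%N by rewrite /X mulnA leq_mul2r nle orbT.
have CX : (C0 * #|E| ^ (2 * p) <= C0 * X)%N by rewrite leq_mul2l fP orbT.
have qX : (q <= X)%N by apply: leq_trans szL _; apply: leq_trans mm fP.
move: X (ftest #|E|) (3 ^ p)%N (nfaces A) #|E| (C0 * _ ^ _)%N
  mm2 m1 mf nX nf CX qX arrT m_gt0 Tc Ts {fP mm nle szL f_gt0 leNm}.
move=> X f T n m CP mm2 m1 mf nX nf CX qX arrT m_gt0 Tc Ts.
have pn : (n * p <= T * X * p)%N by rewrite leq_mul2r nX orbT.
have pm : (m * p <= X * p)%N by rewrite leq_mul2r m1 orbT.
have pmm : (m * m * p <= X * p)%N by rewrite leq_mul2r mm2 orbT.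
have X1 : (1 <= X)%N by apply: leq_trans m1.
have {}Tc : (tC <= X * p + 4 * X + 2 * X + X)%N.
  apply: leq_trans Tc _; rewrite !mulnDr mulnA; lia.
have {}Ts : (tS <= T * X + 4 * (T * X * p) + 44 * (T * X) +
    (X + 2 * (X * p) + 2 * X + 4 * X) + 20 * X)%N.
  apply: leq_trans Ts _; rewrite !mulnDr; nia.
nia.
Qed.
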